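(* Let $A\in\mathbb{R}^{n\times n}$, $b_1,\dots,b_m\in\mathbb{R}^n$ with $m\ge1$, and $T>0$. Let $C\subseteq\Delta_m$ be nonempty, compact and convex, and suppose that $C\cap X_T\neq\emptyset$. Let $f\in\{f_{\rm V},f_{\rm A}\}$. Then the problem of minimizing $f(p)$ subject to $p\in C\cap X_T$ has an optimal solution. Moreover, the domain-aware Armijo projected gradient method (described in the context, with $U=X_T$) is well-defined for every initialization $p^{(0)}\in C\cap X_T$ (every backtracking loop terminates after finitely many step-size reductions), and all accepted iterates remain in the compact initial sublevel set $\mathcal F^{(0)}=\{p\in C\cap X_T\mid f(p)\le f(p^{(0)})\}$. With $\varepsilon=0$, the algorithm either terminates at an optimal solution or generates an infinite sequence that converges to an optimal solution (uniqueness of the optimal solution is not assumed). In the infinite case, for any optimal solution $p^\star$, with $f^\star:=f(p^\star)$, and every integer $K\ge0$, $$\min_{k=0,\dots,K}\|\mathcal G_{\alpha_k}(p^{(k)})\|\le\sqrt{\frac{f(p^{(0)})-f^\star}{\sigma\underline\alpha(K+1)}},$$ $$f(p^{(K)})-f^\star\le\frac{\|p^{(0)}-p^\star\|^2+2\bar\alpha\big(f(p^{(0)})-f^\star\big)/\sigma}{2\underline\alpha(K+1)},$$ and $\|\mathcal G_{\alpha_k}(p^{(k)})\|\to0$ as $k\to\infty$.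
   Context: Scoring problem: $\Delta_m:=\{p\in\mathbb{R}^m\mid p_i\ge0,\ \sum_{i=1}^m p_i=1\}$; $W_i(T):=\int_0^T e^{At}b_ib_i^\top e^{A^\top t}\,dt$; $W(p,T):=\sum_{i=1}^m p_iW_i(T)$ for $p\in\mathbb{R}^m$; $X_T:=\{p\in\mathbb{R}^m\mid W(p,T)\succ O\}$ (positive definite), an open convex set; for $p\in X_T$, $f_{\rm V}(p):=-\log\det W(p,T)$ and $f_{\rm A}(p):=\operatorname{tr}(W(p,T)^{-1})$. Notation: $\|\cdot\|$ is the Euclidean norm, $\|\cdot\|_2$ the spectral norm, $P_C$ the Euclidean projection onto $C$, $X_T^c=\mathbb{R}^m\setminus X_T$, $\operatorname{dist}(A,B)=\inf\{\|a-b\|: a\in A,b\in B\}$, $\operatorname{dist}(q,B)=\operatorname{dist}(\{q\},B)$. Gradient mapping: for $p\in C\cap X_T$ and $\alpha>0$, $\mathcal G_\alpha(p):=\alpha^{-1}\big(p-P_C(p-\alpha\nabla f(p))\big)$. The constant $\underline\alpha$: $d:=\operatorname{dist}(\mathcal F^{(0)},X_T^c)$, $r:=\min\{1,d/2\}$, $\mathcal K_r:=\{q\in\mathbb{R}^m\mid \operatorname{dist}(q,\mathcal F^{(0)})\le r\}$ (here $d>0$ and $\mathcal K_r$ is a compact subset of $X_T$), $G:=\max\{1,\max_{p\in\mathcal F^{(0)}}\|\nabla f(p)\|\}$, $L:=\max\{1,\max_{q\in\mathcal K_r}\|\nabla^2 f(q)\|_2\}$, $\alpha_\star:=\min\{r/G,\,2(1-\sigma)/L\}$,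 and $\underline\alpha:=\min\{\bar\alpha,\rho\alpha_\star\}>0$. Domain-aware Armijo projected gradient method (with $U=X_T$). Input: $p^{(0)}\in C\cap U$, $\bar\alpha>0$, $\sigma,\rho\in(0,1)$, $\varepsilon\ge0$. For $k=0,1,\dots$: (backtracking loop) start with $\alpha:=\bar\alpha$ and repeat: set $q:=P_C(p^{(k)}-\alpha\nabla f(p^{(k)}))$; if $q\in U$ and (tested only when $q\in U$) $f(q)\le f(p^{(k)})+\sigma\nabla f(p^{(k)})^\top(q-p^{(k)})$, accept the trial by setting $\alpha_k:=\alpha$, $\tilde p^{(k)}:=q$ and exit the loop; otherwise replace $\alpha$ by $\rho\alpha$ and repeat. After acceptance, if $\|\tilde p^{(k)}-p^{(k)}\|/\alpha_k\le\varepsilon$, terminate and return $p^{(k)}$; otherwise set $p^{(k+1)}:=\tilde p^{(k)}$. *)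

(* Defs.v *)
From HB Require Import structures.
From mathcomp Require Import all_boot all_order all_algebra.
From mathcomp Require Import all_classical all_reals all_analysis.
Set Implicit Arguments.
Unset Strict Implicit.
Unset Printing Implicit Defensive.
Import Order.TTheory GRing.Theory Num.Theory.
Import numFieldNormedType.Exports.
Local Open Scope classical_set_scope.
Local Open Scope ring_scope.

(* The library norm `|x| on matrices is the sup norm, so the Euclidean norm is
   introduced separately; both induce the same topology on 'rV[R]_m. *)
Definition dotp (R : realType) (m : nat) (u v : 'rV[R]_m) : R :=
  \sum_(i < m) u 0 i * v 0 i.

Definition norm2 (R : realType) (m : nat) (u : 'rV[R]_m) : R :=
  Num.sqrt (\sum_(i < m) u 0 i ^+ 2).

(* Row-vector convention: x *m M^T is the row vector of M x. *)
Definition spectral_norm (R : realType) (m : nat) (M : 'M[R]_m) : R :=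
  sup [set norm2 (x *m M^T) | x in [set x : 'rV[R]_m | norm2 x <= 1]].

(* Extended-real valued, so that the distance to the empty set is +oo. *)
Definition set_dist (R : realType) (m : nat) (A B : set 'rV[R]_m) : \bar R :=
  ereal_inf [set (norm2 (p.1 - p.2))%:E | p in A `*` B].

(* Some nearest point of C; it exists and is unique when C is nonempty, compact
   and convex. *)
Definition proj (R : realType) (m : nat) (C : set 'rV[R]_m) (x : 'rV[R]_m) :
    'rV[R]_m :=
  xget 0 [set y | C y /\ forall z, C z -> norm2 (x - y) <= norm2 (x - z)].

Definition grad (R : realType) (m : nat) (f : 'rV[R]_m -> R) (p : 'rV[R]_m) :
    'rV[R]_m :=
  \row_(i < m) 'D_(delta_mx 0 i) f p.

Definition hessian (R : realType) (m : nat) (f : 'rV[R]_m -> R)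
    (p : 'rV[R]_m) : 'M[R]_m :=
  \matrix_(i < m, j < m)
    'D_(delta_mx 0 i) (fun q : 'rV[R]_m => 'D_(delta_mx 0 j) f q) p.

Definition mxexp (R : realType) (n : nat) (M : 'M[R]_n) : 'M[R]_n :=
  limn (series (fun k : nat => (k`!%:R)^-1 *: M ^+ k)).

Definition posdefmx (R : realType) (n : nat) (M : 'M[R]_n) : Prop :=
  M^T = M /\ forall x : 'cV[R]_n, x != 0 -> 0 < (x^T *m M *m x) 0 0.

Definition simplex (R : realType) (m : nat) : set 'rV[R]_m :=
  [set p | (forall i, 0 <= p 0 i) /\ \sum_(i < m) p 0 i = 1].

Definition gramian1 (R : realType) (n : nat) (A : 'M[R]_n) (b : 'cV[R]_n)
    (T : R) : 'M[R]_n :=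
  \matrix_(k < n, l < n)
    (\int[lebesgue_measure]_(t in `[0%R, T])
       (mxexp (t *: A) *m b *m b^T *m mxexp (t *: A^T)) k l)%R.

Definition gramian (R : realType) (n m : nat) (A : 'M[R]_n)
    (b : 'I_m -> 'cV[R]_n) (T : R) (p : 'rV[R]_m) : 'M[R]_n :=
  \sum_(i < m) p 0 i *: gramian1 A (b i) T.

Definition gramian_domain (R : realType) (n m : nat) (A : 'M[R]_n)
    (b : 'I_m -> 'cV[R]_n) (T : R) : set 'rV[R]_m :=
  [set p | posdefmx (gramian A b T p)].

(* The two scores are meaningful on gramian_domain only; elsewhere they take the
   default values of ln and invmx. That domain is open, so gradients and
   Hessians at its points do not depend on these defaults. *)
Definition fV (R : realType) (n m : nat) (A : 'M[R]_n)
    (b : 'I_m -> 'cV[R]_n) (T : R) (p : 'rV[R]_m) : R :=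
  - ln (\det (gramian A b T p)).

Definition fA (R : realType) (n m : nat) (A : 'M[R]_n)
    (b : 'I_m -> 'cV[R]_n) (T : R) (p : 'rV[R]_m) : R :=
  \tr (invmx (gramian A b T p)).

Definition optimal (R : realType) (m : nat) (C U : set 'rV[R]_m)
    (f : 'rV[R]_m -> R) (p : 'rV[R]_m) : Prop :=
  (C `&` U) p /\ forall q, (C `&` U) q -> f p <= f q.

Definition sublevel (R : realType) (m : nat) (C U : set 'rV[R]_m)
    (f : 'rV[R]_m -> R) (p0 : 'rV[R]_m) : set 'rV[R]_m :=
  [set p | (C `&` U) p /\ f p <= f p0].

Definition trial (R : realType) (m : nat) (C : set 'rV[R]_m)
    (f : 'rV[R]_m -> R) (p : 'rV[R]_m) (a : R) : 'rV[R]_m :=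
  proj C (p - a *: grad f p).

Definition gradient_mapping (R : realType) (m : nat) (C : set 'rV[R]_m)
    (f : 'rV[R]_m -> R) (a : R) (p : 'rV[R]_m) : 'rV[R]_m :=
  a^-1 *: (p - proj C (p - a *: grad f p)).

Definition accepted (R : realType) (m : nat) (C U : set 'rV[R]_m)
    (f : 'rV[R]_m -> R) (sigma : R) (p : 'rV[R]_m) (a : R) : Prop :=
  let q := trial C f p a in
  U q /\ f q <= f p + sigma * dotp (grad f p) (q - p).

(* backtrack C U f sigma rho p a a' q: the backtracking loop at p, entered with
   step size a, exits after finitely many reductions with accepted step size a'
   and accepted trial point q. *)
Inductive backtrack (R : realType) (m : nat) (C U : set 'rV[R]_m)
    (f : 'rV[R]_m -> R) (sigma rho : R) (p : 'rV[R]_m) :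
    R -> R -> 'rV[R]_m -> Prop :=
| backtrack_accept (a : R) :
    accepted C U f sigma p a ->
    backtrack C U f sigma rho p a a (trial C f p a)
| backtrack_reduce (a a' : R) (q : 'rV[R]_m) :
    ~ accepted C U f sigma p a ->
    backtrack C U f sigma rho p (rho * a) a' q ->
    backtrack C U f sigma rho p a a' q.

(* iterate C U f abar sigma rho eps p0 k p: the method started at p0 reaches
   iteration k, and its k-th iterate is p. *)
Inductive iterate (R : realType) (m : nat) (C U : set 'rV[R]_m)
    (f : 'rV[R]_m -> R) (abar sigma rho eps : R) (p0 : 'rV[R]_m) :
    nat -> 'rV[R]_m -> Prop :=
| iterate_init : iterate C U f abar sigma rho eps p0 0%N p0
| iterate_next (k : nat) (p q : 'rV[R]_m) (a : R) :
    iterate C U f abar sigma rho eps p0 k p ->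
    backtrack C U f sigma rho p abar a q ->
    ~ (norm2 (q - p) / a <= eps) ->
    iterate C U f abar sigma rho eps p0 k.+1 q.

Definition returns (R : realType) (m : nat) (C U : set 'rV[R]_m)
    (f : 'rV[R]_m -> R) (abar sigma rho eps : R) (p0 : 'rV[R]_m)
    (p : 'rV[R]_m) : Prop :=
  exists (k : nat) (a : R) (q : 'rV[R]_m),
    [/\ iterate C U f abar sigma rho eps p0 k p,
        backtrack C U f sigma rho p abar a q &
        norm2 (q - p) / a <= eps].

Definition infinite_run (R : realType) (m : nat) (C U : set 'rV[R]_m)
    (f : 'rV[R]_m -> R) (abar sigma rho eps : R) (p0 : 'rV[R]_m)
    (p : nat -> 'rV[R]_m) (a : nat -> R) : Prop :=
  p 0%N = p0 /\
  forall k : nat,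
    backtrack C U f sigma rho (p k) abar (a k) (p k.+1) /\
    ~ (norm2 (p k.+1 - p k) / a k <= eps).

Definition safe_radius (R : realType) (m : nat) (C U : set 'rV[R]_m)
    (f : 'rV[R]_m -> R) (p0 : 'rV[R]_m) : R :=
  fine (mine 1%:E (2^-1%:E * set_dist (sublevel C U f p0) (~` U)))%E.

Definition safe_nbhd (R : realType) (m : nat) (C U : set 'rV[R]_m)
    (f : 'rV[R]_m -> R) (p0 : 'rV[R]_m) : set 'rV[R]_m :=
  [set q | (set_dist [set q] (sublevel C U f p0)
             <= (safe_radius C U f p0)%:E)%E].

(* The suprema in grad_bound and hessian_bound are maxima of continuous functions
   on compact sets when f is one of the two scores and U its domain. *)
Definition grad_bound (R : realType) (m : nat) (C U : set 'rV[R]_m)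
    (f : 'rV[R]_m -> R) (p0 : 'rV[R]_m) : R :=
  Num.max 1 (sup [set norm2 (grad f p) | p in sublevel C U f p0]).

Definition hessian_bound (R : realType) (m : nat) (C U : set 'rV[R]_m)
    (f : 'rV[R]_m -> R) (p0 : 'rV[R]_m) : R :=
  Num.max 1 (sup [set spectral_norm (hessian f q) | q in safe_nbhd C U f p0]).

Definition step_star (R : realType) (m : nat) (C U : set 'rV[R]_m)
    (f : 'rV[R]_m -> R) (sigma : R) (p0 : 'rV[R]_m) : R :=
  Num.min (safe_radius C U f p0 / grad_bound C U f p0)
          (2 * (1 - sigma) / hessian_bound C U f p0).

Definition step_lower (R : realType) (m : nat) (C U : set 'rV[R]_m)
    (f : 'rV[R]_m -> R) (abar sigma rho : R) (p0 : 'rV[R]_m) : R :=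
  Num.min abar (rho * step_star C U f sigma p0).

(* Main.v *)
From Pilot Require Import Defs.
From HB Require Import structures.
From mathcomp Require Import all_boot all_order all_algebra.
From mathcomp Require Import all_classical all_reals all_analysis.
From mathcomp Require Import ring lra.
Import Order.TTheory GRing.Theory Num.Theory.
Import numFieldNormedType.Exports.
(* [proj] is the Euclidean projection below, not a coordinate map of a product. *)
Import Pilot.Defs.
Local Open Scope classical_set_scope.
Local Open Scope ring_scope.
Set Implicit Arguments.
Unset Strict Implicit.
Unset Printing Implicit Defensive.

(** The argument separates the two scores from the method.

    On the side of the scores, [W p] is linear in [p] with symmetric
    coefficients, because the exponential commutes with transposition. So the
    domain where [W p] is positive definite is open and convex, and the
    derivatives of both scores along a direction [v] are traces of products of
    [P = (W p)^-1] and [V = W v]. Factoring [P = B B^T] turns the second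
    derivatives [tr (P V P V)] and [2 tr (P V P V P)] into sums of squares, which
    gives convexity ([logdet_smooth_convex], [trinv_smooth_convex]). The same
    factorisation gives the coercivity estimate [|x|^2 <= tr P * x^T (W p) x]
    ([posdef_coercive]); on a sublevel set it becomes a closed condition on [p],
    so a sublevel set does not approach the boundary of the domain and is
    compact ([logdet_sublevel_compact], [trinv_sublevel_compact]). A minimum is
    therefore attained.

    On the side of the method, let [f] be any smooth convex function with
    compact sublevel sets. From a point of the initial sublevel set, a step of
    size at most [step_star] moves by at most [safe_radius], hence inside the
    region where the Hessian is bounded by [hessian_bound]; the second-order
    upper bound together with the variational inequality of the projection
    ([proj_variational]) gives the Armijo inequality ([small_step_accepted]). So
    backtracking stops, with a step at least [step_lower], and the objective
    decreases.

    For an accepted step from [p] to [q] and a feasible [x], convexity, the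
    Armijo test and the projection inequality combine into
    [2 a (f p - f x) <= |p - x|^2 - |q - x|^2 + 2 a (f p - f q) / sigma]
    ([accepted_progress]). Hence, when [x] is optimal,
    [|p k - x|^2 + (2 abar / sigma) f (p k)] decreases by at least
    [2 step_lower (f (p k) - f x)] at each step. Telescoping gives the rate on
    the values; telescoping the Armijo inequality gives the rate on the gradient
    mapping. Values tend to the minimum, so by compactness the iterates have an
    optimal cluster point; taking that point for [x], the monotone quantity has a
    subsequence tending to its least possible value, so the whole sequence
    converges ([cluster_limit]). *)

(** * Euclidean geometry and projection onto a compact convex set *)

Section Euclidean.
Context {R : realType} {m : nat}.
Implicit Types (u v w : 'rV[R]_m) (a : R).

Lemma dotpC u v : dotp u v = dotp v u.
Proof. by apply: eq_bigr => i _; rewrite mulrC. Qed.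

Lemma dotpDr u v w : dotp u (v + w) = dotp u v + dotp u w.
Proof. by rewrite -big_split; apply: eq_bigr => i _; rewrite mxE mulrDr. Qed.

Lemma dotpZr a u v : dotp u (a *: v) = a * dotp u v.
Proof. by rewrite mulr_sumr; apply: eq_bigr => i _; rewrite mxE mulrCA. Qed.

Lemma dotpNr u v : dotp u (- v) = - dotp u v.
Proof. by rewrite -scaleN1r dotpZr mulN1r. Qed.

Lemma dotpBr u v w : dotp u (v - w) = dotp u v - dotp u w.
Proof. by rewrite dotpDr dotpNr. Qed.

Lemma dotpDl u v w : dotp (u + v) w = dotp u w + dotp v w.
Proof. by rewrite !(dotpC _ w) dotpDr. Qed.

Lemma dotpZl a u v : dotp (a *: u) v = a * dotp u v.
Proof. by rewrite dotpC dotpZr dotpC. Qed.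

Lemma dotpNl u v : dotp (- u) v = - dotp u v.
Proof. by rewrite dotpC dotpNr dotpC. Qed.

Lemma dotpBl u v w : dotp (u - v) w = dotp u w - dotp v w.
Proof. by rewrite !(dotpC _ w) dotpBr. Qed.

Lemma norm2_ge0 u : 0 <= norm2 u.
Proof. exact: sqrtr_ge0. Qed.

Lemma dotpp u : dotp u u = norm2 u ^+ 2.
Proof.
rewrite sqr_sqrtr; first by apply: eq_bigr => i _; rewrite expr2.
by apply: sumr_ge0 => i _; rewrite sqr_ge0.
Qed.

Lemma normr_le_norm2 u : `|u| <= norm2 u.
Proof.
rewrite [leLHS]/Num.norm /= mx_normrE; apply/bigmax_leP; split=> [|[i j] _ /=].
  exact: norm2_ge0.
rewrite -sqrtr_sqr ler_wsqrtr// (ord1 i) (bigD1 j)//= lerDl.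
by apply: sumr_ge0 => k _; rewrite sqr_ge0.
Qed.

Lemma norm2_eq0 u : norm2 u = 0 -> u = 0.
Proof.
move=> u0; apply/normr0_eq0/eqP; rewrite eq_le normr_ge0 andbT.
by rewrite -u0 normr_le_norm2.
Qed.

Lemma norm2Z a u : norm2 (a *: u) = `|a| * norm2 u.
Proof.
have : norm2 (a *: u) ^+ 2 = (`|a| * norm2 u) ^+ 2.
  by rewrite -dotpp dotpZl dotpZr dotpp exprMn real_normK ?num_real// expr2 mulrA.
by move/eqP; rewrite eqrXn2 ?mulr_ge0 ?norm2_ge0// => /eqP.
Qed.

Lemma norm2N u : norm2 (- u) = norm2 u.
Proof. by rewrite -scaleN1r norm2Z normrN1 mul1r. Qed.

Lemma norm2B u v : norm2 (u - v) = norm2 (v - u).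
Proof. by rewrite -norm2N opprB. Qed.

Lemma norm2_0 : norm2 (0 : 'rV[R]_m) = 0.
Proof. by rewrite -(scale0r 0) norm2Z normr0 mul0r. Qed.

(** Expanding [|b u - c v|^2 >= 0] with [b = |v|^2] and [c = u . v]. *)
Lemma dotp_sqr_le u v : dotp u v ^+ 2 <= norm2 u ^+ 2 * norm2 v ^+ 2.
Proof.
have [v0|v0] := eqVneq (norm2 v) 0.
  by rewrite (norm2_eq0 v0) -(scale0r 0) dotpZr norm2Z normr0 !mul0r expr0n mulr0.
have vgt : 0 < norm2 v by rewrite lt_neqAle eq_sym v0 norm2_ge0.
have := sqr_ge0 (norm2 ((norm2 v ^+ 2) *: u - dotp u v *: v)).
rewrite -[X in _ <= X]dotpp !(dotpBl, dotpBr, dotpZl, dotpZr) (dotpC v u) !dotpp.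
set a := norm2 u; set b := norm2 v in vgt *; set c := dotp u v => h.
have {h} : 0 <= b ^+ 2 * (a ^+ 2 * b ^+ 2 - c ^+ 2).
  by move: h; congr (_ <= _); ring.
by rewrite pmulr_rge0 ?exprn_gt0// subr_ge0.
Qed.

Lemma dotp_le_norm2 u v : dotp u v <= norm2 u * norm2 v.
Proof.
apply: le_trans (ler_norm _) _.
rewrite -ler_sqr ?nnegrE ?mulr_ge0 ?norm2_ge0// real_normK ?num_real//.
by rewrite exprMn dotp_sqr_le.
Qed.

Lemma norm2_continuous : continuous (@norm2 R m).
Proof.
move=> u; apply: (@continuous_comp _ _ _ _ Num.sqrt); last exact: sqrt_continuous.
apply: (continuous_big (op := +%R)) => //; first exact: add_continuous.
move=> i _; under eq_fun do rewrite expr2.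
by move=> x; apply: continuousM; exact: coord_continuous.
Qed.

Lemma sqr_norm2_row k (M : 'M[R]_(k, m)) i :
  norm2 (row i M) ^+ 2 = \sum_j M i j ^+ 2.
Proof. by rewrite -dotpp; apply: eq_bigr => j _; rewrite !mxE expr2. Qed.

End Euclidean.

Section Projection.
Context {R : realType} {m : nat} (C : set 'rV[R]_m).
Hypotheses (C0 : C !=set0) (Cc : compact C).
Implicit Types x y z : 'rV[R]_m.

Lemma proj_nearest x :
  C (proj C x) /\ forall z, C z -> norm2 (x - proj C x) <= norm2 (x - z).
Proof.
apply: (@xgetPex _ 0 [set y | C y /\ forall z, C z -> norm2 (x - y) <= norm2 (x - z)]).
have [|y yC ymin] := @compact_EVT_min _ R (fun y => norm2 (x - y)) C C0 Cc.
  apply: continuous_subspaceT => y.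
  apply: (@continuous_comp _ _ _ (fun y => x - y)); last exact: norm2_continuous.
  by apply: continuousB; [exact: cst_continuous|exact: id].
by exists y; split=> [|z Cz]; [rewrite inE in yC|apply: ymin; rewrite inE].
Qed.

Lemma proj_in x : C (proj C x).
Proof. by have [] := proj_nearest x. Qed.

Hypothesis Ccvx : @convex_set R 'rV[R]_m C.

Lemma convex_segment x y t : C x -> C y -> 0 <= t <= 1 -> C (x + t *: (y - x)).
Proof.
move=> Cx Cy /andP[t0 t1].
have := Ccvx (x := y) (y := x) (Itv01 t0 t1).
rewrite !inE => /(_ Cy Cx) /=; congr C; rewrite /conv /=.
by rewrite /unstable.onem scalerBl scale1r scalerBr addrCA.
Qed.

(** First-order optimality of the nearest point [q]: moving from [q] towards
    [z] by a fraction [t] changes [|x - .|^2] by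
    [- 2 t (x - q) . (z - q) + t^2 |z - q|^2], which cannot be negative. *)
Lemma proj_variational x z : C z -> dotp (x - proj C x) (z - proj C x) <= 0.
Proof.
move=> Cz; have [Cq qmin] := proj_nearest x; set q := proj C x in Cq qmin *.
rewrite leNgt; apply/negP => pos.
set c := dotp _ _ in pos; set b := norm2 (z - q).
have b0 : 0 <= b ^+ 2 by exact: sqr_ge0.
pose t := Num.min 1 (c / (b ^+ 2 + 1)).
have den : 0 < b ^+ 2 + 1 by lra.
have t0 : 0 < t by rewrite lt_min ltr01 divr_gt0.
have t1 : t <= 1 by rewrite ge_min lexx.
have tc : t * (b ^+ 2 + 1) <= c by rewrite -ler_pdivlMr// ge_min lexx orbT.
have := qmin _ (convex_segment Cq Cz (introT andP (conj (ltW t0) t1))).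
rewrite -ler_sqr ?nnegrE ?norm2_ge0// -!dotpp opprD addrA.
rewrite !(dotpBl (x - q)) !(dotpBr _ (x - q)) dotpZl !dotpZr dotpZl.
rewrite (dotpC (z - q)) -/c (dotpp (z - q)) -/b => h.
have : t * (2 * c) <= t * (t * b ^+ 2) by nra.
by rewrite ler_pM2l//; nra.
Qed.

(** The variational inequality with [z = x]: a projected gradient step moves
    along a descent direction. *)
Lemma proj_descent x g a : C x ->
  norm2 (proj C (x - a *: g) - x) ^+ 2 <= - a * dotp g (proj C (x - a *: g) - x).
Proof.
move=> Cx; have := proj_variational (x - a *: g) Cx.
set q := proj _ _; rewrite -dotpp.
have -> : x - a *: g - q = - (q - x) - a *: g by rewrite opprB addrAC.
rewrite -[x - q]opprB dotpNr (dotpBl (- (q - x))) dotpNl dotpZl.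
by lra.
Qed.

Lemma proj_step_le x g a : C x -> 0 <= a ->
  norm2 (proj C (x - a *: g) - x) <= a * norm2 g.
Proof.
move=> Cx a0; have := proj_descent g a Cx; set d := _ - x => h.
have [->|d0] := eqVneq (norm2 d) 0; first by rewrite mulr_ge0 ?norm2_ge0.
have dgt : 0 < norm2 d by rewrite lt_neqAle eq_sym d0 norm2_ge0.
rewrite -(ler_pM2r dgt) -expr2; apply: le_trans h _.
rewrite mulNr -mulrN -dotpNr -mulrA ler_wpM2l//.
by apply: le_trans (dotp_le_norm2 _ _) _; rewrite norm2N.
Qed.

End Projection.

(** * Spectral norm and second-order expansions along lines *)

Lemma cvg_mx {K : numFieldType} {T : Type} {m n : nat} (F : set_system T)
    (M : T -> 'M[K]_(m, n)) (A : 'M[K]_(m, n)) : Filter F ->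
  (forall i j, M t i j @[t --> F] --> A i j) -> M t @[t --> F] --> A.
Proof.
move=> FF MA P [Q nQ QP].
have : F [set t | forall i j, Q i j (M t i j)]; last first.
  by apply: (@filterS _ F FF) => t; exact: QP.
by apply: filter_forall => i; apply: filter_forall => j; exact/MA/nQ.
Qed.

Section SpectralNorm.
Context {R : realType} {m : nat}.
Implicit Types (M : 'M[R]_m) (x : 'rV[R]_m).

(** A continuous upper bound of the spectral norm: it shows that the suprema of
    spectral norms below are taken over bounded sets. *)
Definition frobenius M : R := Num.sqrt (\sum_i \sum_j M i j ^+ 2).

Lemma norm2_mulmx_frobenius M x : norm2 (x *m M^T) <= frobenius M * norm2 x.
Proof.
rewrite -[norm2 x]ger0_norm ?norm2_ge0// -sqrtr_sqr -sqrtrM; last first.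
  by do 2 (apply: sumr_ge0 => ? _); exact: sqr_ge0.
rewrite ler_wsqrtr// mulr_suml; apply: ler_sum => i _.
have -> : (x *m M^T) 0 i = dotp (row i M) x.
  by rewrite mxE; apply: eq_bigr => j _; rewrite !mxE mulrC.
by rewrite -sqr_norm2_row dotp_sqr_le.
Qed.

Lemma frobenius_ge0 M : 0 <= frobenius M.
Proof. exact: sqrtr_ge0. Qed.

Lemma frobenius_continuous : continuous frobenius.
Proof.
move=> M; apply: (@continuous_comp _ _ _ _ Num.sqrt); last exact: sqrt_continuous.
apply: (continuous_big (op := +%R)) => [|i _]; first exact: add_continuous.
apply: (continuous_big (op := +%R)) => [|j _]; first exact: add_continuous.
under eq_fun do rewrite expr2.
by move=> N; apply: continuousM; exact: coord_continuous.
Qed.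

Let image_ub M :
  ubound [set norm2 (x *m M^T) | x in [set x : 'rV[R]_m | norm2 x <= 1]]
    (frobenius M).
Proof.
move=> _ [x /= x1 <-]; apply: le_trans (norm2_mulmx_frobenius _ _) _.
by rewrite ler_piMr// frobenius_ge0.
Qed.

Lemma spectral_norm_le_frobenius M : spectral_norm M <= frobenius M.
Proof.
apply: ge_sup; last exact: image_ub.
by exists (norm2 ((0 : 'rV_m) *m M^T)), 0; rewrite //= norm2_0.
Qed.

Lemma norm2_mulmx_spectral M x : norm2 (x *m M^T) <= spectral_norm M * norm2 x.
Proof.
have [x0|x0] := eqVneq (norm2 x) 0.
  by rewrite (norm2_eq0 x0) mul0mx norm2_0 mulr0.
have xgt : 0 < norm2 x by rewrite lt_neqAle eq_sym x0 norm2_ge0.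
rewrite -ler_pdivrMr//; apply: ub_le_sup; first by exists (frobenius M).
exists ((norm2 x)^-1 *: x) => /=.
  by rewrite norm2Z ger0_norm ?invr_ge0 ?norm2_ge0// mulVf.
by rewrite -scalemxAl norm2Z ger0_norm ?invr_ge0 ?norm2_ge0// mulrC.
Qed.

Lemma quadratic_le_spectral M x :
  dotp (x *m M) x <= spectral_norm M * norm2 x ^+ 2.
Proof.
have -> : dotp (x *m M) x = dotp (x *m M^T) x.
  rewrite /dotp.
  under eq_bigr do rewrite mxE mulr_suml.
  under [RHS]eq_bigr do rewrite mxE mulr_suml.
  rewrite exchange_big; apply: eq_bigr => i _; apply: eq_bigr => j _.
  by rewrite mxE; ring.
apply: le_trans (dotp_le_norm2 _ _) _; rewrite expr2 mulrA ler_wpM2r ?norm2_ge0//.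
exact: norm2_mulmx_spectral.
Qed.

End SpectralNorm.

Section OneVariable.
Context {R : realType}.

(** Twice integrating [phi'' <= B]: the function
    [phi t - t phi' 0 - B t^2 / 2] has a nonincreasing derivative that
    vanishes at [0]. *)
Lemma second_order_upper (phi psi chi : R -> R) (B : R) :
  (forall t : R, 0 <= t <= 1 -> is_derive t 1 phi (psi t)) ->
  (forall t : R, 0 <= t <= 1 -> is_derive t 1 psi (chi t)) ->
  (forall t : R, 0 <= t <= 1 -> chi t <= B) ->
  phi 1 <= phi 0 + psi 0 + B / 2.
Proof.
move=> dphi dpsi chiB.
have nincr (k dk : R -> R) : (forall t : R, 0 <= t <= 1 -> is_derive t 1 k (dk t)) ->
    (forall t : R, 0 <= t <= 1 -> dk t <= 0) -> forall t : R, 0 <= t <= 1 -> k t <= k 0.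
  move=> hk hdk t /andP[t0 t1].
  have inoo (s : R) : s \in `]0, 1[%R -> 0 <= s <= 1.
    by rewrite in_itv/= => /andP[/ltW -> /ltW ->].
  apply: (@ler0_derive1_le_cc R k 0 1) => //; rewrite ?in_itv/= ?lexx ?ler01 ?t0//.
  - by move=> s /inoo/hk [].
  - by move=> s /inoo s01; rewrite derive1E; have [_ ->] := hk _ s01; exact: hdk.
  - apply: derivable_within_continuous => s; rewrite in_itv/= => s01.
    by have [] := hk _ s01.
have h1 t : 0 <= t <= 1 -> psi t - psi 0 - B * t <= 0.
  move=> t01.
  have := nincr (fun t => psi t - B * t) (fun t => chi t - B) _ _ t t01.
  have dlin (s : R) : 0 <= s <= 1 -> is_derive s 1 (fun t => psi t - B * t) (chi s - B).
    move=> s01; have := dpsi _ s01 => ?.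
    by apply: is_derive_eq; rewrite [B%:A]mulr1.
  move=> /(_ dlin); rewrite mulr0 subr0 => h.
  suff : psi t - B * t <= psi 0 by lra.
  by apply: h => s s01; rewrite subr_le0 chiB.
have dquad (s : R) : 0 <= s <= 1 ->
    is_derive s 1 (fun t => phi t - psi 0 * t - B / 2 * t ^+ 2)
      (psi s - psi 0 - B * s).
  move=> s01; have := dphi _ s01 => ?.
  apply: is_derive_eq; rewrite ![_%:A]mulr1 -[X in _ - X]/(_ * _); lra.
have := nincr _ _ dquad h1 1; rewrite ler01 lexx => /(_ isT).
by rewrite !mulr1 expr1n mulr0 expr0n /= mulr0 !subr0; lra.
Qed.

End OneVariable.

Section Lines.
Context {R : realType} {m : nat}.

Lemma is_derive_line (f : 'rV[R]_m -> R) (p d : 'rV[R]_m) (t df : R) :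
  is_derive (p + t *: d) d f df -> is_derive t 1 (fun s => f (p + s *: d)) df.
Proof.
have E : (fun h : R =>
      h^-1 *: (((fun s => f (p + s *: d)) \o shift t) (h *: 1) - f (p + t *: d)))
    = (fun h : R => h^-1 *: ((f \o shift (p + t *: d)) (h *: d) - f (p + t *: d))).
  apply/funext => h /=; congr (_ *: (f _ - _)).
  by rewrite [h%:A]mulr1 scalerDl addrCA.
case=> dv eqdf; split; first by rewrite /derivable E.
by rewrite -eqdf /derive E.
Qed.

Lemma is_derive_from_line (f : 'rV[R]_m -> R) (p d : 'rV[R]_m) (df : R) :
  is_derive (0 : R) 1 (fun s => f (p + s *: d)) df -> is_derive p d f df.
Proof.
have E : (fun h : R =>
      h^-1 *: (((fun s => f (p + s *: d)) \o shift (0 : R)) (h *: 1) - f (p + 0 *: d)))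
    = (fun h : R => h^-1 *: ((f \o shift p) (h *: d) - f p)).
  apply/funext => h /=; congr (_ *: (f _ - f _)).
    by rewrite [h%:A]mulr1 addr0 addrC.
  by rewrite scale0r addr0.
case=> dv eqdf; split; first by rewrite /derivable -E.
by rewrite -eqdf /derive -E.
Qed.

End Lines.

(** * Smooth convex functions *)

(** Convexity and smoothness in the form used by the method: [g] and [H] are the
    gradient and the Hessian of [f] on the open convex set [U], given as
    derivatives in all directions so that they can be restricted to lines. *)
Record smooth_convex (R : realType) (m : nat) (U : set 'rV[R]_m)
    (f : 'rV[R]_m -> R) (g : 'rV[R]_m -> 'rV[R]_m) (H : 'rV[R]_m -> 'M[R]_m) :
    Prop := SmoothConvex {
  sc_open : open U;
  sc_segment : forall x y (t : R),
    U x -> U y -> 0 <= t <= 1 -> U (x + t *: (y - x));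
  sc_grad : forall p v, U p -> is_derive p v f (dotp (g p) v);
  sc_hess : forall p v j, U p ->
    is_derive p v (fun q => g q 0 j) ((v *m H p) 0 j);
  sc_psd : forall p v, U p -> 0 <= dotp (v *m H p) v;
  sc_cont : forall p, U p -> {for p, continuous f};
  sc_cont_grad : forall p j, U p -> {for p, continuous (fun q => g q 0 j)};
  sc_cont_hess : forall p i j, U p -> {for p, continuous (fun q => H q i j)}
}.

Section SmoothConvexTheory.
Context {R : realType} {m : nat} {U : set 'rV[R]_m} {f : 'rV[R]_m -> R}.
Context {g : 'rV[R]_m -> 'rV[R]_m} {H : 'rV[R]_m -> 'M[R]_m}.
Hypothesis sc : smooth_convex U f g H.
Implicit Types p q d v : 'rV[R]_m.

Lemma dotp_delta v i : dotp v (delta_mx 0 i) = v 0 i.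
Proof.
rewrite /dotp (bigD1 i)//= mxE !eqxx mulr1 big1 ?addr0// => j ji.
by rewrite mxE (negbTE ji) andbF mulr0.
Qed.

Lemma gradE p : U p -> grad f p = g p.
Proof.
move=> Up; apply/rowP => i; rewrite mxE.
by have [_ ->] := sc_grad sc (delta_mx 0 i) Up; rewrite dotp_delta.
Qed.

Lemma hessianE p : U p -> hessian f p = H p.
Proof.
move=> Up; apply/matrixP => i j; rewrite mxE.
have gj : \near p, g p 0 j = 'D_(delta_mx 0 j) f p.
  have := sc_open sc; rewrite openE => /(_ _ Up); apply: filterS => q Uq.
  by rewrite -gradE// mxE.
have [_ eqH] := sc_hess sc (delta_mx 0 i) j Up.
by rewrite -(near_eq_derive _ gj) eqH -rowE mxE.
Qed.

Lemma is_derive_slope p d t : U (p + t *: d) ->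
  is_derive t 1 (fun s => dotp (g (p + s *: d)) d)
    (dotp (d *m H (p + t *: d)) d).
Proof.
move=> Ut; rewrite /dotp.
have dj j : is_derive t (1 : R) (fun s => g (p + s *: d) 0 j * d 0 j)
    ((d *m H (p + t *: d)) 0 j * d 0 j).
  have ? := is_derive_line (sc_hess sc d j Ut).
  by apply: is_derive_eq; rewrite /= scaler0 add0r [RHS]mulrC.
have := is_derive_sum (h := fun j (s : R) => g (p + s *: d) 0 j * d 0 j) dj.
by congr is_derive; apply/funext => s; rewrite fct_sumE.
Qed.

Lemma sc_quadratic_upper p q B : U p -> U q ->
  (forall t : R, 0 <= t <= 1 ->
    dotp ((q - p) *m H (p + t *: (q - p))) (q - p) <= B) ->
  f q <= f p + dotp (g p) (q - p) + B / 2.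
Proof.
move=> Up Uq hB.
have Ut (t : R) : 0 <= t <= 1 -> U (p + t *: (q - p)).
  by apply: (sc_segment sc).
have := @second_order_upper R (fun t => f (p + t *: (q - p)))
  (fun t => dotp (g (p + t *: (q - p))) (q - p)) _ B _ _ hB.
rewrite /= scale1r scale0r addr0 [p + _]addrC subrK; apply.
  by move=> t /Ut Upt; apply: is_derive_line; exact: (sc_grad sc).
by move=> t /Ut Upt; exact: is_derive_slope.
Qed.

(** Convexity: the slope along the segment from [p] to [q] is nondecreasing. *)
Lemma sc_gradient_inequality p q : U p -> U q -> f p + dotp (g p) (q - p) <= f q.
Proof.
move=> Up Uq.
have Ut (t : R) : 0 <= t <= 1 -> U (p + t *: (q - p)).
  by apply: (sc_segment sc).
have := @second_order_upper R (fun t => - f (p + t *: (q - p)))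
  (fun t => - dotp (g (p + t *: (q - p))) (q - p))
  (fun t => - dotp ((q - p) *m H (p + t *: (q - p))) (q - p)) 0.
rewrite /= scale1r scale0r addr0 [p + _]addrC subrK mul0r addr0 => h.
rewrite -lerN2 opprD; apply: h => t /Ut Upt.
- by apply: is_deriveN; apply: is_derive_line; exact: (sc_grad sc).
- by apply: is_deriveN; exact: is_derive_slope.
- by rewrite oppr_le0 (sc_psd sc).
Qed.

End SmoothConvexTheory.

(** * Steps that are always accepted *)

Section SafeRadius.
Context {R : realType} {m : nat} (K U : set 'rV[R]_m).
Hypotheses (Kc : compact K) (Uo : open U) (KU : K `<=` U).

(** If the ball of radius [e] around a point of [K] lies in [U], then [e / 2] is
    a margin for all nearby points; compactness makes one margin serve all
    of [K]. *)
Lemma uniform_margin :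
  exists2 e : R, 0 < e & forall p q, K p -> norm2 (p - q) < e -> U q.
Proof.
pose P (e : R) (p : 'rV[R]_m) := forall q, norm2 (p - q) < e -> U q.
have : \forall e \near (0 : R)^'+, K `<=` P e.
  apply: (iffLR (compact_near_coveringP K) Kc _ _ P) => p /KU Up.
  have /nbhs_ballP[e /= e0 eU] : nbhs p U by exact: open_nbhs_nbhs.
  exists (ball p (e / 2), [set s | s < e / 2]).
    split => /=; first by apply: nbhsx_ballx; rewrite divr_gt0.
    by apply: nbhs_right_lt; rewrite divr_gt0.
  move=> [p' s] [/=]; rewrite -ball_normE /= => pp' se q qs; apply: eU.
  rewrite -ball_normE /=; have -> : p - q = (p - p') + (p' - q) by rewrite addrA subrK.
  apply: le_lt_trans (ler_normD _ _) _; rewrite [ltRHS](splitr e).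
  apply: ltrD => //; apply: le_lt_trans (normr_le_norm2 _) _.
  exact: lt_trans se.
move=> nearP; near (0 : R)^'+ => e; exists e => // p q Kp.
by move: p Kp q; near: e.
Unshelve. all: by end_near. Qed.

Lemma set_dist_gt0 : (0 < set_dist K (~` U))%E.
Proof.
have [e e0 eU] := uniform_margin.
apply: (@lt_le_trans _ _ e%:E); first by rewrite lte_fin.
apply: le_ereal_inf_tmp => _ [[p q] [/= Kp nUq] <-]; rewrite lee_fin leNgt.
by apply/negP => /(eU _ _ Kp).
Qed.

End SafeRadius.

Section SafeStep.
Context {R : realType} {m : nat} {U : set 'rV[R]_m} {f : 'rV[R]_m -> R}.
Context {g : 'rV[R]_m -> 'rV[R]_m} {H : 'rV[R]_m -> 'M[R]_m}.
Hypothesis sc : smooth_convex U f g H.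
Variables (C : set 'rV[R]_m) (p0 : 'rV[R]_m).
Let K := sublevel C U f p0.
Hypothesis Kc : compact K.
Let r := safe_radius C U f p0.
Implicit Types p q : 'rV[R]_m.

Let KU : K `<=` U. Proof. by move=> p [[]]. Qed.

(** The factor [1/2] in the definition of the radius leaves room on both sides:
    points within [r] of the sublevel set are still [r] away from leaving [U]. *)
Lemma safe_radius_spec : 0 < r /\ ((2 * r)%:E <= set_dist K (~` U))%E.
Proof.
have := set_dist_gt0 Kc (sc_open sc) KU; rewrite /r /safe_radius -/K.
case: (set_dist _ _) => [d| |//] d0.
  rewrite -EFinM -EFin_min /= !lee_fin lt_min ltr01.
  rewrite lte_fin in d0; split; first by lra.
  have : Num.min 1 (2^-1 * d) <= 2^-1 * d by rewrite ge_min lexx orbT.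
  by lra.
by rewrite gt0_muley ?lte_fin ?invr_gt0// min_l ?leey//= ltr01 leey.
Qed.

Let r0 : 0 < r. Proof. by have [] := safe_radius_spec. Qed.

Lemma safe_radius_in p q : K p -> norm2 (p - q) < 2 * r -> U q.
Proof.
move=> Kp pq; apply: contrapT => nUq; have [_] := safe_radius_spec.
apply/negP; rewrite -ltNge; apply: le_lt_trans (_ : (norm2 (p - q))%:E < _)%E.
  by apply: ereal_inf_lbound; exists (p, q).
by rewrite lte_fin.
Qed.

Lemma safe_nbhd_near p q : K p -> norm2 (p - q) <= r -> safe_nbhd C U f p0 q.
Proof.
move=> Kp pq; apply: (@le_trans _ _ (norm2 (q - p))%:E).
  by apply: ereal_inf_lbound; exists (q, p).
by rewrite lee_fin norm2B.
Qed.

(** A compact set between [safe_nbhd] and [U]: the radius [3 r / 2] is above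
    [r], so that the infimum in the definition of [safe_nbhd] need not be
    attained, and below the distance [2 r] at which [U] may be left. *)
Let thick := [set x.1 + x.2 | x in K `*` [set u | norm2 u <= 3 / 2 * r]].

Let thick_compact : compact thick.
Proof.
apply: continuous_compact; first exact/continuous_subspaceT/add_continuous.
apply: compact_setX => //; apply: bounded_closed_compact.
  exists (3 / 2 * r); split; first exact: num_real.
  move=> M rM u /= ur; apply: le_trans (normr_le_norm2 u) _.
  exact: le_trans ur (ltW rM).
apply: (@closed_comp _ _ _ [set x | x <= 3 / 2 * r]); last exact: closed_le.
by move=> u _; exact: norm2_continuous.
Qed.

Let thickU : thick `<=` U.
Proof.
move=> _ [[p u] [/= Kp ur] <-]; apply: (safe_radius_in Kp).
by have := r0; rewrite opprD addrA subrr add0r norm2N; lra.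
Qed.

Let safe_thick : safe_nbhd C U f p0 `<=` thick.
Proof.
move=> q; rewrite /safe_nbhd /= -/r -/K => qr.
have /ereal_inf_lt[_ [[q' p] [/= -> Kp] <-]] :
    (set_dist [set q] K < (3 / 2 * r)%:E)%E.
  by apply: le_lt_trans qr _; rewrite lte_fin; have := r0; lra.
rewrite lte_fin => qp; exists (p, q - p); last by rewrite /= addrC subrK.
by split=> //=; exact: ltW.
Qed.

Let bounded_on (A : set 'rV[R]_m) (k : 'rV[R]_m -> R) : compact A ->
  (forall p, A p -> {for p, continuous k}) -> exists B, forall p, A p -> k p <= B.
Proof.
move=> Ac kc; have [A0|/set0P A0] := eqVneq A set0.
  by exists 0 => p; rewrite A0.
have [|c _ cmax] := @compact_EVT_max _ R k A A0 Ac.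
  by apply: continuous_in_subspaceT => p; rewrite inE => /kc.
by exists (k c) => p Ap; apply: cmax; rewrite inE.
Qed.

Lemma grad_le_bound p : K p -> norm2 (g p) <= grad_bound C U f p0.
Proof.
move=> Kp; rewrite /grad_bound le_max; apply/orP; right.
rewrite -(gradE sc (KU Kp)); apply: ub_le_sup; last by exists p.
have [q Kq|B hB] := bounded_on (k := fun q => norm2 (g q)) Kc.
  apply: (@continuous_comp _ _ _ g); last exact: norm2_continuous.
  by apply: (cvg_mx (F := nbhs q)) => i j; rewrite ord1; exact: (sc_cont_grad sc) (KU Kq).
by exists B => _ [q Kq <-]; rewrite (gradE sc (KU Kq)); exact: hB.
Qed.

Lemma hessian_le_bound q : safe_nbhd C U f p0 q ->
  spectral_norm (H q) <= hessian_bound C U f p0.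
Proof.
move=> Sq; rewrite /hessian_bound le_max; apply/orP; right.
rewrite -(hessianE sc (thickU (safe_thick Sq))); apply: ub_le_sup; last by exists q.
have [p Fp|B hB] := bounded_on (k := fun q => frobenius (H q)) thick_compact.
  apply: (@continuous_comp _ _ _ H); last exact: frobenius_continuous.
  by apply: (cvg_mx (F := nbhs p)) => i j; exact: (sc_cont_hess sc) (thickU Fp).
exists B => _ [p /safe_thick Fp <-]; rewrite (hessianE sc (thickU Fp)).
exact: le_trans (spectral_norm_le_frobenius _) (hB _ Fp).
Qed.

Let G1 : 1 <= grad_bound C U f p0.
Proof. by rewrite /grad_bound le_max lexx. Qed.

Let L1 : 1 <= hessian_bound C U f p0.
Proof. by rewrite /hessian_bound le_max lexx. Qed.

Lemma step_star_gt0 sigma : sigma < 1 -> 0 < step_star C U f sigma p0.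
Proof.
move=> s1; have [G L] := (lt_le_trans ltr01 G1, lt_le_trans ltr01 L1).
by rewrite /step_star lt_min !divr_gt0// mulr_gt0// subr_gt0.
Qed.

Hypotheses (C0 : C !=set0) (Cc : compact C).
Hypothesis Ccvx : @convex_set R 'rV[R]_m C.

(** The step bound [r / G] keeps the whole segment to the trial point inside
    [safe_nbhd], where the Hessian is at most [L]; the second-order upper bound
    and the optimality of the projection then give sufficient decrease as soon
    as [a L / 2 <= 1 - sigma]. *)
Lemma small_step_accepted sigma p a : sigma < 1 -> K p -> 0 < a ->
  a <= step_star C U f sigma p0 -> accepted C U f sigma p a.
Proof.
move=> s1 Kp a0; have [G L] := (lt_le_trans ltr01 G1, lt_le_trans ltr01 L1).
rewrite /step_star le_min !ler_pdivlMr// => /andP[aG aL].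
have Cp : C p by case: Kp => [[]].
rewrite /accepted /trial (gradE sc (KU Kp)).
have desc := proj_descent C0 Cc Ccvx (g p) a Cp.
have step := proj_step_le C0 Cc Ccvx (g p) Cp (ltW a0).
set q := proj C _ in desc step *.
have qr : norm2 (q - p) <= r.
  apply: le_trans step _; apply: le_trans aG.
  by rewrite ler_pM2l// grad_le_bound.
have near_p (t : R) : 0 <= t <= 1 -> safe_nbhd C U f p0 (p + t *: (q - p)).
  move=> /andP[t0 t1]; apply: (safe_nbhd_near Kp).
  rewrite opprD addrA subrr add0r norm2N norm2Z ger0_norm//.
  by apply: le_trans qr; rewrite ler_piMl// norm2_ge0.
have Uq : U q.
  have := thickU (safe_thick (near_p 1 _)).
  by rewrite scale1r addrC subrK; apply; rewrite ler01 lexx.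
split=> //.
have := sc_quadratic_upper sc (B := hessian_bound C U f p0 * norm2 (q - p) ^+ 2) (KU Kp) Uq.
move=> /(_ _)/le_trans; apply.
  move=> t /near_p St; apply: le_trans (quadratic_le_spectral _ _) _.
  by rewrite ler_wpM2r ?sqr_ge0// hessian_le_bound.
rewrite -addrA lerD2l.
set s := dotp _ _ in desc *; set b := norm2 _ ^+ 2 in desc *.
set M := hessian_bound _ _ _ _ in L aL *.
have b0 : 0 <= b by exact: sqr_ge0.
(* The slope [s] is nonpositive, so [M b <= - M a s <= - 2 (1 - sigma) s]. *)
have s0 : s <= 0 by rewrite -(pmulr_rle0 _ a0); lra.
have : M * b <= M * (- a * s) by rewrite ler_pM2l.
have : (2 * (1 - sigma) - a * M) * s <= 0 by rewrite mulr_ge0_le0// subr_ge0.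
by lra.
Qed.

End SafeStep.

(** * The Armijo projected gradient method *)

Section OptimalSolution.
Context {R : realType} {m : nat}.

Lemma optimal_exists (C U : set 'rV[R]_m) (f : 'rV[R]_m -> R) p0 :
  (forall p, U p -> {for p, continuous f}) -> (C `&` U) p0 ->
  compact (sublevel C U f p0) -> exists p, optimal C U f p.
Proof.
move=> fcont CUp0; set K := sublevel C U f p0 => Kc.
have K0 : K !=set0 by exists p0.
have [|c cK cmin] := @compact_EVT_min _ R f K K0 Kc.
  by apply: continuous_in_subspaceT => p; rewrite inE => -[[_ /fcont]].
rewrite inE in cK; case: cK => CUc fc; exists c; split=> // q CUq.
have [fq|/ltW fq] := leP (f q) (f p0); last exact: le_trans fc fq.
by apply: cmin; rewrite inE.
Qed.

End OptimalSolution.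

Section ArmijoProjectedGradient.
Context {R : realType} {m : nat}.
Variables (C U : set 'rV[R]_m) (f : 'rV[R]_m -> R).
Hypotheses (C0 : C !=set0) (Cc : compact C).
Hypothesis Ccvx : @convex_set R 'rV[R]_m C.
Hypothesis fconv : forall p q, U p -> U q ->
  f p + dotp (grad f p) (q - p) <= f q.
Hypothesis fcont : forall p, U p -> {for p, continuous f}.
Variables (p0 : 'rV[R]_m) (abar sigma rho astar : R).
Hypothesis CUp0 : (C `&` U) p0.
Let K := sublevel C U f p0.
Hypothesis Kc : compact K.
Hypotheses (abar0 : 0 < abar) (sigma0 : 0 < sigma) (rho01 : 0 < rho < 1).
Hypothesis astar0 : 0 < astar.
Hypothesis small_accepted : forall p a, K p -> 0 < a -> a <= astar ->
  accepted C U f sigma p a.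
Implicit Types p q x : 'rV[R]_m.

Let rho0 : 0 < rho. Proof. by case/andP: rho01. Qed.
Let rho1 : rho < 1. Proof. by case/andP: rho01. Qed.

(** A rejected step is larger than [astar], so the reduced step that replaces it
    is larger than [rho * astar]. *)
Lemma backtrack_spec p a a' q : backtrack C U f sigma rho p a a' q ->
  K p -> 0 < a ->
  [/\ accepted C U f sigma p a', q = trial C f p a',
      Num.min a (rho * astar) <= a' & a' <= a].
Proof.
move=> bt Kp; elim: bt => {a a' q} [a acc a0|a a' q nacc _ IH a0].
  by split=> //; rewrite ge_min lexx.
have a_gt : astar < a.
  by rewrite ltNge; apply/negP => /(small_accepted Kp a0).
have [|acc qE lo hi] := IH; first by rewrite mulr_gt0.
split; [exact: acc|exact: qE| |].
  apply: le_trans lo; rewrite le_min !ge_min (ler_pM2l rho0) (ltW a_gt).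
  by rewrite lexx !orbT.
by apply: le_trans hi _; rewrite (ger_pMl _ a0) (ltW rho1).
Qed.

Lemma backtrack_exists p a : K p -> 0 < a ->
  exists a' q, backtrack C U f sigma rho p a a' q.
Proof.
move=> Kp.
have stop n : forall a, 0 < a -> rho ^+ n * a <= astar ->
    exists a' q, backtrack C U f sigma rho p a a' q.
  elim: n => [|n IH] b b0 hb.
    exists b, (trial C f p b); apply: backtrack_accept; apply: small_accepted => //.
    by rewrite expr0 mul1r in hb.
  have [acc|nacc] := pselect (accepted C U f sigma p b).
    by exists b, (trial C f p b); exact: backtrack_accept.
  have [||a' [q bt]] := IH (rho * b).
  - by rewrite mulr_gt0.
  - by rewrite mulrA -exprSr.
  - by exists a', q; exact: backtrack_reduce.
move=> a0.
have : \forall n \near \oo, rho ^+ n * a <= astar.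
  have : rho ^+ n @[n --> \oo] --> (0 : R).
    by apply: cvg_expr; rewrite ger0_norm// ltW.
  move/cvgrPdist_lt => /(_ (astar / a)); rewrite divr_gt0// => /(_ isT).
  apply: filterS => n; rewrite sub0r normrN ger0_norm ?exprn_ge0 ?(ltW rho0)//.
  by rewrite ltr_pdivlMr// => /ltW.
by case=> n _ /(_ n (leqnn n)); exact: stop.
Qed.

Section AcceptedStep.
Variables (p : 'rV[R]_m) (a : R).
Hypotheses (Kp : K p) (a0 : 0 < a) (acc : accepted C U f sigma p a).
Let q := trial C f p a.

Let Cp : C p. Proof. by case: Kp => [[]]. Qed.
Let Up : U p. Proof. by case: Kp => [[]]. Qed.

Lemma accepted_decrease : f q <= f p - sigma * (norm2 (q - p) ^+ 2 / a).
Proof.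
case: acc => _ /le_trans; apply; rewrite -mulrN lerD2l ler_pM2l//.
have := proj_descent C0 Cc Ccvx (grad f p) a Cp.
by rewrite -/q -/(trial C f p a) -/q lerNr ler_pdivrMr//; lra.
Qed.

Lemma accepted_sublevel : K q.
Proof.
split; first by split; [exact: proj_in|case: acc].
apply: le_trans accepted_decrease _; case: Kp => _; apply: le_trans.
by rewrite gerBl mulr_ge0 ?divr_ge0 ?sqr_ge0 ?ltW.
Qed.

(** Convexity bounds [f p - f x] by [g . (p - q) + g . (q - x)]: the Armijo test
    controls the first product, the projection inequality the second. *)
Lemma accepted_progress x : (C `&` U) x ->
  2 * a * (f p - f x) <= norm2 (p - x) ^+ 2 - norm2 (q - x) ^+ 2
    + 2 * a * (f p - f q) / sigma.
Proof.
move=> [Cx Ux].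
have cv := fconv Up Ux.
have := proj_variational C0 Cc Ccvx (p - a *: grad f p) Cx.
rewrite -/(trial C f p a) -/q.
have armijo : dotp (grad f p) (p - q) <= (f p - f q) / sigma.
  rewrite ler_pdivlMr// -opprB dotpNr; case: acc => _; rewrite -/q; lra.
rewrite -/(trial C f p a) -/q => vi.
have -> : norm2 (p - x) ^+ 2 = norm2 (p - q) ^+ 2 + norm2 (q - x) ^+ 2
    + 2 * dotp (p - q) (q - x).
  rewrite -!dotpp; have -> : p - x = (p - q) + (q - x) by rewrite addrA subrK.
  by rewrite !(dotpDl (p - q)) !(dotpDr _ (p - q)) (dotpC (q - x)); ring.
have {}vi : a * dotp (grad f p) (q - x) <= dotp (p - q) (q - x).
  move: vi; have -> : p - a *: grad f p - q = (p - q) - a *: grad f p.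
    by rewrite addrAC.
  by rewrite -(opprB q x) dotpNr (dotpBl (p - q)) dotpZl; lra.
have split_slope : - dotp (grad f p) (x - p)
    = dotp (grad f p) (p - q) + dotp (grad f p) (q - x).
  by rewrite -dotpNr opprB -dotpDr addrA subrK.
have : a * (f p - f x) <= a * ((f p - f q) / sigma) + a * dotp (grad f p) (q - x).
  by rewrite -mulrDr ler_pM2l//; lra.
have := sqr_ge0 (norm2 (p - q)).
rewrite -(mulrA _ (f p - f q)); lra.
Qed.

Lemma fixed_optimal : q = p -> optimal C U f p.
Proof.
move=> qp; split=> [|x CUx]; first by case: Kp.
have := accepted_progress CUx; rewrite qp !subrr mulr0 mul0r addr0.
by rewrite pmulr_rle0 ?mulr_gt0// subr_le0.
Qed.

End AcceptedStep.

Lemma sublevel_init : K p0. Proof. by []. Qed.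

Lemma iterate_sublevel eps k p :
  iterate C U f abar sigma rho eps p0 k p -> K p.
Proof.
elim=> {k p} [|k p q a _ Kp bt _]; first exact: sublevel_init.
have [acc -> lo _] := backtrack_spec bt Kp abar0.
apply: accepted_sublevel => //; apply: lt_le_trans lo.
by rewrite lt_min abar0 mulr_gt0.
Qed.

Lemma backtrack_sublevel p a q :
  K p -> backtrack C U f sigma rho p abar a q -> K q.
Proof.
move=> Kp bt; have [acc -> lo _] := backtrack_spec bt Kp abar0.
apply: accepted_sublevel => //; apply: lt_le_trans lo.
by rewrite lt_min abar0 mulr_gt0.
Qed.

Lemma returns_optimal p : returns C U f abar sigma rho 0 p0 p -> optimal C U f p.
Proof.
case=> k [a [q [it bt stop]]]; have Kp := iterate_sublevel it.
have [acc qE lo _] := backtrack_spec bt Kp abar0.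
have a0 : 0 < a by apply: lt_le_trans lo; rewrite lt_min abar0 mulr_gt0.
apply: (fixed_optimal Kp a0 acc); rewrite -qE; apply/eqP.
rewrite -subr_eq0; apply/eqP/norm2_eq0/eqP; rewrite eq_le norm2_ge0 andbT.
by move: stop; rewrite pmulr_lle0 ?invr_gt0.
Qed.

(** Without a return, choosing one outcome of the backtracking loop at each point
    of the sublevel set generates an infinite run. *)
Lemma returns_or_infinite :
  (exists p, returns C U f abar sigma rho 0 p0 p) \/
  (exists (p : nat -> 'rV[R]_m) (a : nat -> R), infinite_run C U f abar sigma rho 0 p0 p a).
Proof.
have [|noret] := pselect (exists p, returns C U f abar sigma rho 0 p0 p); first by left.
right.
pose step p (aq : R * 'rV[R]_m) := backtrack C U f sigma rho p abar aq.1 aq.2.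
have ex_step p : {aq | K p -> step p aq}.
  apply: cid; have [Kp|nKp] := pselect (K p); last by exists (0, 0) => /nKp.
  by have [a [q bt]] := backtrack_exists Kp abar0; exists (a, q).
pose nxt p := (sval (ex_step p)).2; pose stepsize p := (sval (ex_step p)).1.
pose pp k := iter k nxt p0.
have it k : iterate C U f abar sigma rho 0 p0 k (pp k).
  elim: k => [|k IH]; first exact: iterate_init.
  have bt := svalP (ex_step (pp k)) (iterate_sublevel IH).
  apply: (iterate_next IH bt) => stop; apply: noret.
  by exists (pp k), k, (stepsize (pp k)), (nxt (pp k)); split;
    [exact: IH|exact: bt|exact: stop].
exists pp, (stepsize \o pp); split=> // k.
have bt := svalP (ex_step (pp k)) (iterate_sublevel (it k)).
split=> // stop; apply: noret.
by exists (pp k), k, (stepsize (pp k)), (nxt (pp k)); split;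
  [exact: it|exact: bt|exact: stop].
Qed.

Section InfiniteRun.
Variables (p : nat -> 'rV[R]_m) (a : nat -> R).
Hypothesis run : infinite_run C U f abar sigma rho 0 p0 p a.
Let G k := norm2 (gradient_mapping C f (a k) (p k)).
Let alow := Num.min abar (rho * astar).

Let alow0 : 0 < alow. Proof. by rewrite lt_min abar0 mulr_gt0. Qed.

Let Kp k : K (p k).
Proof.
case: run => p00 bt; elim: k => [|k IH]; first by rewrite p00; exact: sublevel_init.
by have [b _] := bt k; exact: backtrack_sublevel IH b.
Qed.

Let step k : [/\ accepted C U f sigma (p k) (a k), p k.+1 = trial C f (p k) (a k),
  alow <= a k & a k <= abar].
Proof. by case: run => _ /(_ k) [bt _]; exact: backtrack_spec bt (Kp k) abar0. Qed.

Let a0 k : 0 < a k. Proof. by have [_ _ lo _] := step k; exact: lt_le_trans lo. Qed.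

Let CU k : (C `&` U) (p k). Proof. by case: (Kp k). Qed.

Let decrease k : sigma * alow * G k ^+ 2 <= f (p k) - f (p k.+1).
Proof.
have [acc pS lo _] := step k; have := accepted_decrease (Kp k) (a0 k) acc.
rewrite -pS; set b := norm2 _ => h.
have -> : G k = b / a k.
  rewrite /G /gradient_mapping norm2Z -/(trial C f (p k) (a k)) -pS norm2B mulrC.
  by rewrite ger0_norm// invr_ge0 ltW.
apply: le_trans (_ : sigma * (a k * (b / a k) ^+ 2) <= _).
  by rewrite -mulrA ler_pM2l// ler_wpM2r// sqr_ge0.
have -> : a k * (b / a k) ^+ 2 = b ^+ 2 / a k by field; rewrite gt_eqF.
by lra.
Qed.

Let f_noninc k : f (p k.+1) <= f (p k).
Proof.
rewrite -subr_ge0; apply: le_trans (decrease k).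
by apply: mulr_ge0 (sqr_ge0 _); apply: mulr_ge0; exact: ltW.
Qed.

Let f_le j k : (j <= k)%N -> f (p k) <= f (p j).
Proof.
move=> jk; rewrite -(subnK jk); elim: (k - j)%N => [//|i IH].
exact: le_trans (f_noninc _) IH.
Qed.

Section Rates.
Variable x : 'rV[R]_m.
Hypothesis xopt : optimal C U f x.

Let fx k : f x <= f (p k). Proof. by case: xopt => _; apply; exact: CU. Qed.

Lemma min_gradient_mapping_rate n :
  \big[Num.min/G 0%N]_(k < n.+1) G k
    <= Num.sqrt ((f p0 - f x) / (sigma * alow * n.+1%:R)).
Proof.
set mn := \big[_/_]_(_ < _) _.
have mn0 : 0 <= mn.
  by apply/bigmin_geP; split=> [|i _]; exact: norm2_ge0.
have sa0 : 0 < sigma * alow by rewrite mulr_gt0.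
have tel j : (j <= n.+1)%N -> sigma * alow * mn ^+ 2 * j%:R <= f p0 - f (p j).
  elim: j => [_|j IH jn].
    by rewrite mulr0; case: run => -> _; rewrite subrr.
  have mnG : mn <= G j.
    exact: (@bigmin_le _ _ _ (G 0%N) (Ordinal jn) (fun k : 'I_n.+1 => G k)).
  have := IH (ltnW jn); have := decrease j.
  have : sigma * alow * mn ^+ 2 <= sigma * alow * G j ^+ 2.
    by rewrite ler_pM2l// ler_sqr ?nnegrE// norm2_ge0.
  by rewrite -[j.+1%:R]natr1; lra.
rewrite -[leLHS]ger0_norm// -sqrtr_sqr ler_wsqrtr// ler_pdivlMr ?mulr_gt0//.
have := tel n.+1 (leqnn _); have := fx n.+1.
by rewrite mulrA (mulrC (mn ^+ 2)); lra.
Qed.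

Let c := 2 * abar / sigma.
Let c0 : 0 < c. Proof. by rewrite /c divr_gt0// mulr_gt0. Qed.

(** The Lyapunov inequality behind both the rate and the convergence of the
    iterates. *)
Let lyapunov k : 2 * alow * (f (p k) - f x)
  <= (norm2 (p k - x) ^+ 2 + c * f (p k))
     - (norm2 (p k.+1 - x) ^+ 2 + c * f (p k.+1)).
Proof.
have [acc pS lo hi] := step k.
have := accepted_progress (Kp k) (a0 k) acc (proj1 xopt); rewrite -pS => h.
have : 2 * alow * (f (p k) - f x) <= 2 * a k * (f (p k) - f x).
  by rewrite ler_wpM2r ?subr_ge0// ler_pM2l.
have : 2 * a k * (f (p k) - f (p k.+1)) / sigma <= c * (f (p k) - f (p k.+1)).
  rewrite /c [leRHS]mulrAC ler_pM2r ?invr_gt0// ler_wpM2r ?subr_ge0 ?f_noninc//.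
  by rewrite ler_pM2l.
by lra.
Qed.

Lemma value_rate n :
  f (p n) - f x
    <= (norm2 (p0 - x) ^+ 2 + 2 * abar * (f p0 - f x) / sigma)
       / (2 * alow * n.+1%:R).
Proof.
have tel j : (j <= n.+1)%N -> 2 * alow * (f (p n) - f x) * j%:R <=
    (norm2 (p0 - x) ^+ 2 + c * f p0) - (norm2 (p j - x) ^+ 2 + c * f (p j)).
  elim: j => [_|j IH jn].
    by rewrite mulr0; case: run => -> _; rewrite subrr.
  have := IH (ltnW jn); have := lyapunov j.
  have : 2 * alow * (f (p n) - f x) <= 2 * alow * (f (p j) - f x).
    by rewrite ler_pM2l ?mulr_gt0// lerB// f_le.
  by rewrite -[j.+1%:R]natr1; lra.
rewrite ler_pdivlMr ?mulr_gt0//.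
have := tel n.+1 (leqnn _); have := sqr_ge0 (norm2 (p n.+1 - x)).
have : c * f x <= c * f (p n.+1) by rewrite ler_pM2l.
have -> : 2 * abar * (f p0 - f x) / sigma = c * (f p0 - f x) by rewrite /c mulrAC.
have -> : (f (p n) - f x) * (2 * alow * n.+1%:R)
  = 2 * alow * (f (p n) - f x) * n.+1%:R by ring.
by lra.
Qed.

Let f_near_min e : 0 < e -> \forall k \near \oo, f (p k) < f x + e.
Proof.
move=> e0; set B := norm2 (p0 - x) ^+ 2 + 2 * abar * (f p0 - f x) / sigma.
have : B / (2 * alow) * harmonic k @[k --> \oo] --> B / (2 * alow) * 0.
  by apply: cvgMr; exact: cvg_harmonic.
rewrite mulr0 => /cvgrPdist_lt/(_ e e0); apply: filterS => k.
rewrite sub0r normrN => /(le_lt_trans (ler_norm _)) h.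
rewrite -ltrBlDl; apply: le_lt_trans (value_rate k) _.
by rewrite -/B invfM mulrA.
Qed.

(** The values tend to the minimum [f x], and [f] is continuous at [y]. *)
Lemma cluster_optimal y : K y -> cluster (p @ \oo) y -> optimal C U f y.
Proof.
move=> [CUy _] cly; split=> // z CUz.
apply: le_trans (_ : f x <= _); last by case: xopt => _; apply.
apply/ler_addgt0Pr => e e0; have e20 : 0 < e / 2 by rewrite divr_gt0.
have near_y : nbhs y [set z | f y - e / 2 < f z].
  have /cvgrPdist_lt/(_ _ e20) := fcont (proj2 CUy); apply: filterS => z' /=.
  by rewrite ltr_norml => /andP[_]; lra.
have near_oo : (p @ \oo) [set z | f z < f x + e / 2] by exact: f_near_min.
have [z' [/= h1 h2]] := cly _ _ near_oo near_y.
by lra.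
Qed.

(** The Lyapunov function [|p k - x|^2 + c (f (p k) - f x)] is nonincreasing;
    it is arbitrarily small along a subsequence when [x] is a cluster point,
    hence tends to [0]. *)
Lemma cluster_limit : cluster (p @ \oo) x -> p @ \oo --> x.
Proof.
move=> clx; apply/cvgrPdist_lt => e e0.
have e20 : 0 < e ^+ 2 / 2 by rewrite divr_gt0// exprn_gt0.
have near_x : nbhs x [set z | norm2 (z - x) ^+ 2 < e ^+ 2 / 2].
  have cn : {for x, continuous (fun z : 'rV[R]_m => norm2 (z - x))}.
    apply: (@continuous_comp _ _ _ (fun z : 'rV[R]_m => z - x)).
      by apply: continuousB; [exact: id|exact: cst_continuous].
    exact: norm2_continuous.
  have /cvgrPdist_lt/(_ _ e20) := continuousM cn cn.
  apply: filterS => z /=; rewrite subrr norm2_0 mul0r sub0r normrN expr2.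
  by rewrite ger0_norm// mulr_ge0 ?norm2_ge0.
have near_oo : (p @ \oo) [set z | exists k, z = p k /\ c * (f z - f x) < e ^+ 2 / 2].
  have ec : 0 < e ^+ 2 / 2 / c by rewrite divr_gt0.
  have := f_near_min ec; apply: filterS => k fk; exists k; split=> //.
  by rewrite mulrC -ltr_pdivlMr// ltrBlDl.
have [_ [[k [-> fk]] /= dk]] := clx _ _ near_oo near_x.
have lyap j : norm2 (p (j + k)%N - x) ^+ 2 + c * (f (p (j + k)%N) - f x) < e ^+ 2.
  elim: j => [|j IH]; first by rewrite add0n; lra.
  apply: le_lt_trans IH; have := lyapunov (j + k); rewrite -addSn.
  have : 0 <= 2 * alow * (f (p (j + k)%N) - f x).
    by rewrite !mulr_ge0 ?subr_ge0// ltW.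
  by lra.
exists k => // j /= kj; rewrite -(subnK kj).
rewrite distrC; apply: le_lt_trans (normr_le_norm2 _) _.
rewrite -ltr_sqr ?nnegrE ?norm2_ge0 ?ltW//; apply: le_lt_trans (lyap (j - k)%N).
by rewrite lerDl mulr_ge0 ?subr_ge0// ltW.
Qed.

End Rates.

Lemma iterates_converge : (exists x, optimal C U f x) ->
  exists x, optimal C U f x /\ p @ \oo --> x.
Proof.
move=> [x0 x0opt].
have Fp : ProperFilter (p @ \oo) by exact: fmap_proper_filter.
have [|x [Kx clx]] := Kc Fp; first by exists 0%N => // k _; exact: Kp.
have xopt := cluster_optimal x0opt Kx clx.
by exists x; split=> //; exact: cluster_limit.
Qed.

(** The squared norms are bounded by the successive differences of the values,
    which form a convergent sequence. *)
Lemma gradient_mapping_cvg0 : (exists x, optimal C U f x) -> G @ \oo --> (0 : R).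
Proof.
move=> [x [_ xmin]].
have sa0 : 0 < sigma * alow by rewrite mulr_gt0.
have fcvg : cvgn (f \o p).
  apply: nonincreasing_is_cvgn.
    by move=> j k jk; exact: f_le.
  by exists (f x) => _ [k _ <-]; exact: xmin.
have dcvg : (f (p k) - f (p k.+1)) / (sigma * alow) @[k --> \oo] --> (0 : R).
  rewrite -(mul0r (sigma * alow)^-1); apply: cvgMl.
  rewrite -(subrr (limn (f \o p))); apply: cvgB; first exact: fcvg.
  by have := fcvg; rewrite -[X in X -> _](@cvg_shiftS _ (f \o p)).
have G2 : G k ^+ 2 @[k --> \oo] --> (0 : R).
  apply: (squeeze_cvgr _ (cvg_cst 0) dcvg); apply: nearW => k.
  by rewrite sqr_ge0 /= ler_pdivlMr// mulrC decrease.
have -> : G = (fun k => Num.sqrt (G k ^+ 2)).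
  by apply/funext => k; rewrite sqrtr_sqr ger0_norm// norm2_ge0.
rewrite -[X in _ --> X]sqrtr0.
exact: (continuous_cvg _ (@sqrt_continuous R 0) G2).
Qed.

End InfiniteRun.

End ArmijoProjectedGradient.

(** * Positive definite matrices *)

Section PositiveDefinite.
Context {R : realType}.

Definition qform n (S : 'M[R]_n) (x : 'cV[R]_n) : R := (x^T *m S *m x) 0 0.

Lemma qformE n (S : 'M[R]_n) x :
  qform S x = \sum_i \sum_j S i j * x i 0 * x j 0.
Proof.
rewrite /qform mxE exchange_big; apply: eq_bigr => j _ /=.
rewrite mxE mulr_suml; apply: eq_bigr => i _; rewrite mxE; ring.
Qed.

Lemma sum_sqr_gt0 n (x : 'cV[R]_n) : x != 0 -> 0 < \sum_i x i 0 ^+ 2.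
Proof.
move=> x0; rewrite lt_neqAle sumr_ge0 ?andbT => [|i _]; last exact: sqr_ge0.
apply: contra x0; rewrite eq_sym psumr_eq0 => [/allP h|i _]; last exact: sqr_ge0.
apply/eqP/matrixP => i j; rewrite ord1 mxE; apply/eqP.
by have := h i (mem_index_enum _); rewrite sqrf_eq0.
Qed.

(** Cholesky factorisation, by induction on the Schur complement of the top left
    entry. *)
Lemma posdef_factor n (S : 'M[R]_n) : posdefmx S ->
  exists2 Q, Q \in unitmx & S = Q^T *m Q.
Proof.
elim: n S => [|n IH] S [Ssym Spos].
  by exists 1%:M; rewrite ?unitmx1// flatmx0 [RHS]flatmx0.
pose a := S 0 0; pose u : 'rV_n := @ursubmx _ 1 n 1 n S.
pose D : 'M[R]_n := @drsubmx _ 1 n 1 n S.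
have SE : S = block_mx a%:M u u^T D :> 'M[R]_(1 + n).
  rewrite -[LHS](@submxK _ 1 n 1 n S); congr block_mx.
    by apply/matrixP => i j; rewrite !mxE !ord1 mulr1n; congr (S _ _); apply/val_inj.
  by rewrite /u trmx_ursub Ssym.
have a0 : 0 < a.
  have d0 : delta_mx 0 0 != 0 :> 'cV[R]_n.+1.
    apply/eqP => /matrixP/(_ 0 0); rewrite !mxE !eqxx => /eqP.
    by rewrite oner_eq0.
  by have := Spos _ d0; rewrite trmx_delta -rowE -colE !mxE.
pose s := Num.sqrt a; have s0 : 0 < s by rewrite sqrtr_gt0.
have ss : s * s = a by rewrite -expr2 sqr_sqrtr// ltW.
have schur_pos : posdefmx (D - a^-1 *: (u^T *m u)).
  split=> [|y y0].
    rewrite linearB linearZ /= trmx_mul trmxK; congr (_ - _).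
    by rewrite /D trmx_drsub Ssym.
  have x0 : col_mx (- a^-1 *: (u *m y)) y != 0 :> 'cV[R]_(1 + n).
    by apply: contra y0 => /eqP/(congr1 dsubmx); rewrite col_mxKd linear0 => ->.
  have : 0 < ((col_mx (- a^-1 *: (u *m y)) y)^T *m block_mx a%:M u u^T D
      *m col_mx (- a^-1 *: (u *m y)) y) 0 0 by rewrite -SE; exact: Spos.
  rewrite tr_col_mx mul_row_block mul_row_col.
  have -> : (- a^-1 *: (u *m y))^T = - a^-1 *: (y^T *m u^T).
    by rewrite [LHS]linearZ /= trmx_mul.
  rewrite mul_mx_scalar scalerA mulrN divff ?gt_eqF//.
  rewrite scaleN1r addNr mul0mx add0r -scalemxAl mulmxBr.
  by rewrite scaleNr -scalemxAr mulmxA addrC.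
have [Q Qu QE] := IH _ schur_pos.
suff : exists2 Q0 : 'M[R]_(1 + n), Q0 \in unitmx &
    block_mx a%:M u u^T D = Q0^T *m Q0 by rewrite -SE.
exists (block_mx s%:M (s^-1 *: u) 0 Q : 'M[R]_(1 + n)).
  by rewrite unitmxE det_ublock det_scalar1 unitrM -unitmxE Qu andbT unitfE gt_eqF.
rewrite tr_block_mx mulmx_block tr_scalar_mx trmx0 !mul0mx !addr0.
rewrite mulmx0 addr0 -scalar_mxM ss mul_scalar_mx scalerA divff ?gt_eqF// scale1r.
rewrite linearZ /= mul_mx_scalar scalerA divff ?gt_eqF// scale1r.
congr block_mx; rewrite -QE -scalemxAl -scalemxAr scalerA -invfM ss.
by rewrite addrC subrK.
Qed.

Lemma posdef_unit n (S : 'M[R]_n) : posdefmx S -> S \in unitmx.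
Proof. by move=> /posdef_factor[Q Qu ->]; rewrite unitmx_mul unitmx_tr Qu. Qed.

Lemma posdef_det n (S : 'M[R]_n) : posdefmx S -> 0 < \det S.
Proof.
move=> /posdef_factor[Q Qu ->]; rewrite det_mulmx det_tr -expr2.
by rewrite exprn_even_gt0//= -unitfE -unitmxE.
Qed.

Lemma posdef_invmx n (S : 'M[R]_n) : posdefmx S ->
  exists B : 'M[R]_n, invmx S = B *m B^T.
Proof.
move=> Sp; have [Q Qu SE] := posdef_factor Sp; exists (invmx Q).
apply: (can_inj (mulKmx (posdef_unit Sp))).
rewrite mulmxV ?posdef_unit// SE -mulmxA (mulmxA Q) mulmxV// mul1mx.
by rewrite -trmx_mul mulVmx// trmx1.
Qed.

Lemma posdef_qform_ge0 n (S : 'M[R]_n) x : posdefmx S -> 0 <= qform S x.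
Proof.
move=> Sp; have [->|x0] := eqVneq x 0; last by apply: ltW; exact: (proj2 Sp).
by rewrite /qform mulmx0 mxE.
Qed.

Lemma mxtrace_gram n p (M : 'M[R]_(n, p)) : \tr (M *m M^T) = \sum_i \sum_j M i j ^+ 2.
Proof.
by apply: eq_bigr => i _; rewrite mxE; apply: eq_bigr => j _; rewrite mxE expr2.
Qed.

Lemma mxtrace_gram_ge0 n p (M : 'M[R]_(n, p)) : 0 <= \tr (M *m M^T).
Proof.
by rewrite mxtrace_gram; do 2 (apply: sumr_ge0 => ? _); exact: sqr_ge0.
Qed.

Lemma posdef_trace_inv_ge0 n (S : 'M[R]_n) : posdefmx S -> 0 <= \tr (invmx S).
Proof. by move=> /posdef_invmx[B ->]; exact: mxtrace_gram_ge0. Qed.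

(** With [S^-1 = B B^T] and [y = B^T S x], one has [x = B y] and
    [|y|^2 = x^T S x]; the squared Frobenius norm of [B] is [tr (S^-1)]. *)
Lemma posdef_coercive n (S : 'M[R]_n) (x : 'cV[R]_n) : posdefmx S ->
  \sum_i x i 0 ^+ 2 <= \tr (invmx S) * qform S x.
Proof.
move=> Sp; have [B BE] := posdef_invmx Sp.
have Su := posdef_unit Sp; have Ssym := proj1 Sp.
pose y := B^T *m (S *m x).
have xE : x = B *m y by rewrite /y mulmxA -BE mulmxA mulVmx// mul1mx.
have yE : qform S x = norm2 y^T ^+ 2.
  rewrite -dotpp /qform; transitivity ((y^T *m y) 0 0).
    rewrite {1}/y trmx_mul trmxK trmx_mul Ssym -!mulmxA; congr ((_ *m (_ *m _)) _ _).
    by rewrite -xE.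
  by rewrite mxE; apply: eq_bigr => i _; rewrite !mxE.
rewrite BE mxtrace_gram mulr_suml; apply: ler_sum => i _.
have -> : x i 0 = dotp (row i B) y^T.
  by rewrite {1}xE mxE; apply: eq_bigr => j _; rewrite !mxE.
by rewrite -sqr_norm2_row yE dotp_sqr_le.
Qed.

(** Writing [S^-1 = B B^T], both traces are squared Frobenius norms: of
    [B^T V B] for the first and of [B B^T V B] for the second. *)
Section TraceForms.
Variables (n : nat) (S V : 'M[R]_n).
Hypotheses (Sp : posdefmx S) (Vsym : V^T = V).
Let P := invmx S.

Lemma trace_invmx_sq_ge0 : 0 <= \tr (P *m V *m P *m V).
Proof.
have [B BE] := posdef_invmx Sp; rewrite /P BE.
have -> : \tr (B *m B^T *m V *m (B *m B^T) *m V)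
    = \tr ((B^T *m V *m B) *m (B^T *m V *m B)^T).
  by rewrite !trmx_mul trmxK Vsym -!mulmxA [LHS]mxtrace_mulC !mulmxA.
exact: mxtrace_gram_ge0.
Qed.

Lemma trace_invmx_cube_ge0 : 0 <= \tr (P *m V *m P *m V *m P).
Proof.
have [B BE] := posdef_invmx Sp; rewrite /P BE.
have -> : B *m B^T *m V *m (B *m B^T) *m V *m (B *m B^T)
    = (B *m (B^T *m V *m B)) *m (B *m (B^T *m V *m B))^T.
  by rewrite !trmx_mul trmxK Vsym -!mulmxA.
exact: mxtrace_gram_ge0.
Qed.

End TraceForms.

End PositiveDefinite.

(** * Limits and derivatives of matrix functions *)

Section MatrixLimits.
Context {R : realType} {T : Type} {F : set_system T} {FF : Filter F}.

(** Entrywise convergence, in the form in which limits of sums and products of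
    scalars apply. *)
Definition cvg_entries n p (M : T -> 'M[R]_(n, p)) (A : 'M[R]_(n, p)) : Prop :=
  forall i j, M t i j @[t --> F] --> A i j.

Lemma cvg_entries_cst n p (A : 'M[R]_(n, p)) : cvg_entries (fun=> A) A.
Proof. by move=> i j; exact: cvg_cst. Qed.

Lemma cvg_entries_mul n p q M A N B :
  @cvg_entries n p M A -> @cvg_entries p q N B ->
  cvg_entries (fun t => M t *m N t) (A *m B).
Proof.
move=> MA NB i j; rewrite mxE; under eq_fun do rewrite mxE.
apply: cvg_big => [|k _]; first exact: add_continuous.
by apply: cvgM; [exact: MA|exact: NB].
Qed.

Lemma cvg_trace n M A : @cvg_entries n n M A -> \tr (M t) @[t --> F] --> \tr A.
Proof.
by move=> MA; apply: cvg_big => [|k _]; [exact: add_continuous|exact: MA].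
Qed.

Lemma cvg_det n M A : @cvg_entries n n M A -> \det (M t) @[t --> F] --> \det A.
Proof.
move=> MA; rewrite /determinant.
apply: cvg_big => [|s _]; first exact: add_continuous.
apply: cvgM; first exact: cvg_cst.
by apply: cvg_big => [|i _]; [exact: mul_continuous|exact: MA].
Qed.

Lemma cvg_entries_adj n M A : @cvg_entries n n M A ->
  cvg_entries (fun t => \adj (M t)) (\adj A).
Proof.
move=> MA i j; rewrite mxE; under eq_fun do rewrite mxE.
apply: cvgM; first exact: cvg_cst.
apply: cvg_det => k l; rewrite !mxE; under eq_fun do rewrite !mxE.
exact: MA.
Qed.

Lemma near_unitmx n M A : @cvg_entries n n M A -> A \in unitmx ->
  \forall t \near F, M t \in unitmx.
Proof.
move=> /cvg_det Md; rewrite unitmxE unitfE => A0.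
have /cvgrPdist_lt/(_ `|\det A|) := Md; rewrite normr_gt0 => /(_ A0).
apply: filterS => t; rewrite unitmxE unitfE; apply: contraTneq => ->.
by rewrite subr0 ltxx.
Qed.

Lemma cvg_entries_inv n M A : @cvg_entries n n M A -> A \in unitmx ->
  cvg_entries (fun t => invmx (M t)) (invmx A).
Proof.
move=> MA Au i j.
have detA : \det A != 0 by rewrite -unitfE -unitmxE.
have : (\det (M t))^-1 * \adj (M t) i j @[t --> F] --> invmx A i j.
  rewrite /invmx Au mxE; apply: cvgM; last exact: cvg_entries_adj.
  by apply: cvgV => //; exact: cvg_det.
apply: cvg_trans; apply: near_eq_cvg.
have := near_unitmx MA Au; apply: filterS => t Mu.
by rewrite /invmx Mu [RHS]mxE.
Qed.

End MatrixLimits.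
Arguments cvg_entries {R T} F {n p} M A.

Section MatrixDerivatives.
Context {R : realType} {V : normedModType R}.
Implicit Types (p v : V).

(** Entrywise derivatives, for the product rule with matrix factors. *)
Definition mx_derive n k p v (F : V -> 'M[R]_(n, k)) (dF : 'M[R]_(n, k)) : Prop :=
  forall i j, is_derive p v (fun q => F q i j) (dF i j).

Lemma mx_derive_cst n k p v (A : 'M[R]_(n, k)) : mx_derive p v (fun=> A) 0.
Proof. by move=> i j; rewrite mxE; exact: is_derive_cst. Qed.

Lemma mx_derive_mul n k l p v F dF G dG :
  @mx_derive n k p v F dF -> @mx_derive k l p v G dG ->
  mx_derive p v (fun q => F q *m G q) (dF *m G p + F p *m dG).
Proof.
move=> hF hG i j.
have := is_derive_sum (h := fun s (q : V) => F q i s * G q s j)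
  (fun s => is_deriveM (hF i s) (hG s j)).
rewrite !mxE -big_split /=.
have -> : (\sum_s (fun q : V => F q i s * G q s j)) = (fun q => (F q *m G q) i j).
  by apply/funext => q; rewrite fct_sumE mxE.
move=> h; apply: is_derive_eq; apply: eq_bigr => s _.
by rewrite addrC /GRing.scale /= [dF i s * _]mulrC.
Qed.

Lemma is_derive_trace n p v F dF :
  @mx_derive n n p v F dF -> is_derive p v (fun q => \tr (F q)) (\tr dF).
Proof.
move=> hF.
have := is_derive_sum (h := fun s (q : V) => F q s s) (fun s => hF s s).
have -> // : (\sum_s (fun q : V => F q s s)) = (fun q => \tr (F q)).
by apply/funext => q; rewrite fct_sumE.
Qed.

Lemma cvg_is_derive p v (f : V -> R) (df : R) :
  h^-1 * (f (h *: v + p) - f p) @[h --> 0^'] --> df -> is_derive p v f df.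
Proof.
move=> h; apply: DeriveDef; first by apply/cvg_ex; exists df.
exact: cvg_lim h.
Qed.

End MatrixDerivatives.

Section DeterminantExpansion.
Context {R : realType}.

(** [det (1 + h M)] is the reversed characteristic polynomial of [- M]
    evaluated at [h]; the trace is the second coefficient of that polynomial. *)
Lemma det_1DZ n (M : 'M[R]_n) :
  exists r : {poly R}, [/\ forall h, \det (1%:M + h *: M) = r.[h],
    r`_0 = 1 & r`_1 = \tr M].
Proof.
case: n M => [|n] M.
  exists 1; split=> [h||]; first by rewrite det_mx00 hornerC.
    by rewrite coefC.
  by rewrite coefC /mxtrace big_ord0.
pose q := char_poly (- M).
have sq : size q = n.+2 by exact: size_char_poly.
exists (\poly_(k < n.+2) q`_(n.+1 - k)).
have q_lead : q`_n.+1 = 1.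
  by have /monicP := char_poly_monic (- M); rewrite /lead_coef -/q sq.
split=> [h||]; last 2 first.
- by rewrite coef_poly subn0.
- rewrite coef_poly subSS subn0.
  by have := char_poly_trace (- M) (ltn0Sn n); rewrite /= linearN opprK.
rewrite horner_poly; have [->|h0] := eqVneq h 0.
  rewrite scale0r addr0 det1 big_ord_recl subn0 expr0 mulr1 q_lead big1 ?addr0//.
  by move=> i _; rewrite lift0 expr0n mulr0.
have -> : 1%:M + h *: M = h *: (h^-1%:M - - M).
  by rewrite opprK scalerDr scale_scalar_mx divff.
rewrite detZ.
have -> : \det (h^-1%:M - - M) = q.[h^-1].
  rewrite /q /char_poly -[RHS]/(horner_eval _ _) -det_map_mx; congr (\det _).
  by apply/matrixP => i j; rewrite !mxE rmorphB rmorphMn /= /horner_eval hornerX hornerC.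
rewrite horner_coef sq big_distrr (reindex_inj rev_ord_inj) /=.
apply: eq_bigr => i _; rewrite subSS mulrCA; congr (_ * _).
rewrite exprVn -{1}(subnKC (leq_ord i)) exprD -mulrA divff ?mulr1//.
by rewrite expf_neq0.
Qed.

(** The logarithmic derivative of the determinant along the line [S + h V],
    with [S + h V = S (1 + h S^-1 V)]. *)
Lemma is_derive_ln_det n (S V : 'M[R]_n) : 0 < \det S ->
  is_derive (0 : R) 1 (fun h => ln (\det (S + h *: V))) (\tr (invmx S *m V)).
Proof.
move=> S0; have Su : S \in unitmx by rewrite unitmxE unitfE gt_eqF.
have [r [rE r0 r1]] := det_1DZ (invmx S *m V).
have -> : (fun h => ln (\det (S + h *: V))) = @ln R \o (fun h : R => \det S * r.[h]).
  apply/funext => h /=; rewrite -rE -det_mulmx mulmxDr mulmx1 -scalemxAr.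
  by rewrite mulmxA mulmxV// mul1mx.
have dr : is_derive (0 : R) 1 (fun h => \det S * r.[h]) (\det S * \tr (invmx S *m V)).
  have -> : (fun h : R => \det S * r.[h]) = \det S *: horner r by apply/funext.
  apply: is_derive_eq; congr (_ * _).
  by rewrite horner_coef0 coef_deriv mulr1n.
have dln : is_derive (\det S * r.[0]) (1 : R) (@ln R) (\det S * r.[0])^-1.
  by apply: is_derive1_ln; rewrite horner_coef0 r0 mulr1.
have := @is_derive1_comp R (@ln R) (fun h => \det S * r.[h]) 0 _ _ dln dr.
move=> h; apply: is_derive_eq.
by rewrite horner_coef0 r0 mulr1 mulKf// gt_eqF.
Qed.

End DeterminantExpansion.

(** * The two scores on a linear family of symmetric matrices *)

Section Pencil.
Context {R : realType} {n m : nat}.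
Variable Ws : 'I_m -> 'M[R]_n.
Hypothesis Wsym : forall i, (Ws i)^T = Ws i.
Implicit Types p q v : 'rV[R]_m.

Definition pencil p : 'M[R]_n := \sum_(i < m) p 0 i *: Ws i.

Definition pencil_domain : set 'rV[R]_m := [set p | posdefmx (pencil p)].

Lemma pencilDZ (h : R) v p : pencil (h *: v + p) = h *: pencil v + pencil p.
Proof.
rewrite /pencil scaler_sumr -big_split; apply: eq_bigr => i _.
by rewrite !mxE scalerDl scalerA.
Qed.

Lemma pencil0 : pencil 0 = 0.
Proof. by rewrite /pencil big1// => i _; rewrite mxE scale0r. Qed.

Lemma pencil_sym p : (pencil p)^T = pencil p.
Proof.
rewrite /pencil linear_sum; apply: eq_bigr => i _.
by rewrite linearZ /= Wsym.
Qed.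

Lemma trace_pencil k (A : 'M[R]_(k, n)) (B : 'M[R]_(n, k)) v :
  \tr (A *m pencil v *m B) = \sum_i v 0 i * \tr (A *m Ws i *m B).
Proof.
rewrite /pencil mulmx_sumr mulmx_suml linear_sum; apply: eq_bigr => i _.
by rewrite -scalemxAr -scalemxAl linearZ.
Qed.

Lemma cvg_pencil p : cvg_entries (nbhs p) pencil (pencil p).
Proof.
move=> i j; rewrite /pencil summxE; under eq_fun do rewrite summxE.
apply: cvg_big => [|k _]; first exact: add_continuous.
rewrite mxE; under eq_fun do rewrite mxE.
by apply: cvgM; [exact: coord_continuous|exact: cvg_cst].
Qed.

(** Differentiate [S_h^-1 - S^-1 = S_h^-1 (S - S_h) S^-1], where
    [S_h = S + h V]. *)
Lemma mx_derive_inv_pencil p v : pencil p \in unitmx ->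
  mx_derive p v (fun q => invmx (pencil q))
    (- (invmx (pencil p) *m pencil v *m invmx (pencil p))).
Proof.
move=> Su i j; apply: cvg_is_derive.
set S := pencil p in Su *; set V := pencil v.
have lim_line : cvg_entries (0 : R)^' (fun h => pencil (h *: v + p)) S.
  move=> k l; under eq_fun do rewrite pencilDZ mxE mxE.
  have : h * V k l + S k l @[h --> (0 : R)^'] --> 0 * V k l + S k l.
    apply: cvgD; last exact: cvg_cst.
    by apply: cvgM; [exact: nbhs_dnbhs|exact: cvg_cst].
  by rewrite mul0r add0r.
have inv_line : cvg_entries (0 : R)^' (fun h => invmx (pencil (h *: v + p))) (invmx S).
  exact: cvg_entries_inv.
have : (invmx (pencil (h *: v + p)) *m - (V *m invmx S)) i j @[h --> (0 : R)^']
    --> (invmx S *m - (V *m invmx S)) i j.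
  by apply: cvg_entries_mul => //; exact: cvg_entries_cst.
rewrite mulmxN mulmxA; apply: cvg_trans; apply: near_eq_cvg.
have nz : \forall h \near (0 : R)^', h != 0 by exact: nbhs_dnbhs_neq.
have nu : \forall h \near (0 : R)^', pencil (h *: v + p) \in unitmx.
  exact: near_unitmx lim_line Su.
move: nz nu; apply: filterS2 => h h0.
rewrite pencilDZ -/V -/S => Shu.
have -> : invmx (h *: V + S) *m - (V *m invmx S)
    = h^-1 *: (invmx (h *: V + S) - invmx S).
  apply: (scalerI h0); rewrite scalerA divff// scale1r.
  have -> : invmx (h *: V + S) - invmx S
      = invmx (h *: V + S) *m ((S - (h *: V + S)) *m invmx S).
    by rewrite mulmxBl mulmxBr mulmxV// mulmx1 mulmxA mulVmx// mul1mx.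
  by rewrite opprD addrCA subrr addr0 mulNmx -scalemxAl -scalerN -scalemxAr.
by rewrite !mxE.
Qed.

Lemma cvg_inv_pencil p : pencil_domain p ->
  cvg_entries (nbhs p) (fun q => invmx (pencil q)) (invmx (pencil p)).
Proof. by move=> /posdef_unit; apply: cvg_entries_inv; exact: cvg_pencil. Qed.

Lemma pencil_domain_segment p q (t : R) : pencil_domain p -> pencil_domain q ->
  0 <= t <= 1 -> pencil_domain (p + t *: (q - p)).
Proof.
move=> [_ Sp] [_ Sq] /andP[t0 t1]; split; first exact: pencil_sym.
move=> x x0; have := Sp _ x0; have := Sq _ x0.
have -> : p + t *: (q - p) = t *: q + ((1 - t) *: p + 0).
  by rewrite addr0 scalerBr scalerBl scale1r addrCA.
rewrite !pencilDZ pencil0 addr0 mulmxDr mulmxDl -!(scalemxAr, scalemxAl) !mxE.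
set b := (X in 0 < t * X + _); set a := (X in 0 < _ + _ * X) => b0 a0.
have [->|tn0] := eqVneq t 0; first by rewrite mul0r add0r subr0 mul1r.
have tp : 0 < t by rewrite lt_neqAle eq_sym tn0.
by rewrite ltr_pwDl ?mulr_gt0// mulr_ge0 ?subr_ge0// ltW.
Qed.

(** The coercivity estimate [|x|^2 <= c x^T S x] survives a perturbation of the
    entries by less than [e], which changes [x^T S x] by at most
    [n e |x|^2]. *)
Lemma pencil_domain_open : open pencil_domain.
Proof.
rewrite openE => p Up; rewrite /interior.
set S := pencil p; pose c := \tr (invmx S).
have c0 : 0 <= c by exact: posdef_trace_inv_ge0.
pose e := (c * n%:R + 1)^-1.
have e0 : 0 < e by rewrite invr_gt0 ltr_wpDl// mulr_ge0.
have near_S : \forall q \near p, forall i j, `|pencil q i j - S i j| < e.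
  apply: (@filter_forall _ _ _ (nbhs p)) => i.
  apply: (@filter_forall _ _ _ (nbhs p)) => j.
  have /cvgrPdist_lt/(_ _ e0) := @cvg_pencil p i j.
  by apply: filterS => q; rewrite distrC.
apply: filterS near_S => q qS; split; first exact: pencil_sym.
move=> x x0; rewrite -/(qform (pencil q) x).
set s := \sum_i x i 0 ^+ 2.
have s0 : 0 < s by exact: sum_sqr_gt0.
have coercive : s <= c * qform S x by exact: posdef_coercive.
have perturb : qform S x - qform (pencil q) x <= e * (n%:R * s).
  rewrite !qformE -sumrB.
  have -> : n%:R * s = \sum_(i < n) \sum_(j < n) (x i 0 ^+ 2 + x j 0 ^+ 2) / 2.
    under eq_bigr do rewrite -mulr_suml big_split /= sumr_const card_ord.
    by rewrite -mulr_suml big_split /= sumr_const card_ord sumrMnl -mulr_natl -/s; lra.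
  rewrite mulr_sumr; apply: ler_sum => i _.
  rewrite mulr_sumr -sumrB; apply: ler_sum => j _.
  rewrite -!mulrA -mulrBl.
  apply: le_trans (ler_norm _) _; rewrite normrM.
  apply: ler_pM => //; first by rewrite distrC ltW// qS.
  rewrite normrM; have := sqr_ge0 (`|x i 0| - `|x j 0|).
  rewrite sqrrB !real_normK ?num_real//.
  by lra.
have : c * (qform S x - qform (pencil q) x) <= c * (e * (n%:R * s)).
  by rewrite ler_wpM2l.
have : c * (e * (n%:R * s)) < s.
  have -> : c * (e * (n%:R * s)) = (c * n%:R * e) * s by ring.
  rewrite gtr_pMl// -ltr_pdivlMr// invrK mul1r.
  by rewrite ltrDl.
move=> h1 h2; have : 0 < c * qform (pencil q) x by lra.
by move=> cq; rewrite ltNge; apply/negP => q0; have := mulr_ge0_le0 c0 q0; lra.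
Qed.

Lemma trace_pencilr (A : 'M[R]_n) v :
  \tr (A *m pencil v) = \sum_i v 0 i * \tr (A *m Ws i).
Proof.
rewrite -[A *m _]mulmx1 trace_pencil; apply: eq_bigr => i _.
by rewrite mulmx1.
Qed.

Lemma cvg_trace_inv_pencil p : pencil_domain p ->
  {for p, continuous (fun q => \tr (invmx (pencil q)))}.
Proof. by move=> Up; apply: (cvg_trace (F := nbhs p)); exact: cvg_inv_pencil. Qed.

(** The first derivative of [- ln det S] along [V] is [- tr (S^-1 V)], the second
    is [tr (S^-1 V S^-1 V)]. *)
Section LogDet.

Definition logdet_score p : R := - ln (\det (pencil p)).

Definition logdet_grad p : 'rV[R]_m := \row_j - \tr (invmx (pencil p) *m Ws j).

Definition logdet_hess p : 'M[R]_m := \matrix_(i, j)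
  \tr (invmx (pencil p) *m Ws i *m invmx (pencil p) *m Ws j).

Let hessE p v j : (v *m logdet_hess p) 0 j
  = \tr (invmx (pencil p) *m pencil v *m invmx (pencil p) *m Ws j).
Proof.
rewrite -mulmxA trace_pencil mxE; apply: eq_bigr => i _.
by rewrite !mxE !mulmxA.
Qed.

Lemma logdet_smooth_convex :
  smooth_convex pencil_domain logdet_score logdet_grad logdet_hess.
Proof.
split.
- exact: pencil_domain_open.
- exact: pencil_domain_segment.
- move=> p v Up; apply: is_derive_from_line.
  have -> : dotp (logdet_grad p) v = - \tr (invmx (pencil p) *m pencil v).
    rewrite trace_pencilr -sumrN; apply: eq_bigr => i _.
    by rewrite mxE mulrC mulrN.
  rewrite /logdet_score; under eq_fun do rewrite addrC pencilDZ addrC.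
  by apply: is_deriveN; apply: is_derive_ln_det; exact: posdef_det.
- move=> p v j Up; rewrite hessE.
  have -> : (fun q => logdet_grad q 0 j) = - (fun q => \tr (invmx (pencil q) *m Ws j)).
    by apply/funext => q; rewrite mxE.
  have dinv := mx_derive_inv_pencil v (posdef_unit Up).
  have := is_derive_trace (mx_derive_mul dinv (mx_derive_cst p v (Ws j))).
  rewrite mulmx0 addr0 mulNmx linearN /= => dtr.
  by apply: is_derive_eq; rewrite opprK.
- move=> p v Up.
  have -> : dotp (v *m logdet_hess p) v
      = \tr (invmx (pencil p) *m pencil v *m invmx (pencil p) *m pencil v).
    rewrite trace_pencilr; apply: eq_bigr => j _.
    by rewrite hessE mulrC.
  exact: trace_invmx_sq_ge0 Up (pencil_sym v).
- move=> p Up; apply: continuousN.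
  apply: (@continuous_comp _ _ _ (fun q => \det (pencil q)) (@ln R)).
    by apply: (cvg_det (F := nbhs p)); exact: cvg_pencil.
  by apply: continuous_ln; exact: posdef_det.
- move=> p j Up.
  have -> : (fun q => logdet_grad q 0 j) = (fun q => - \tr (invmx (pencil q) *m Ws j)).
    by apply/funext => q; rewrite mxE.
  apply: continuousN; apply: (cvg_trace (F := nbhs p)).
  apply: cvg_entries_mul; first exact: cvg_inv_pencil.
  exact: cvg_entries_cst.
- move=> p i j Up.
  have -> : (fun q => logdet_hess q i j) = (fun q =>
      \tr (invmx (pencil q) *m Ws i *m invmx (pencil q) *m Ws j)).
    by apply/funext => q; rewrite mxE.
  apply: (cvg_trace (F := nbhs p)); apply: cvg_entries_mul; last exact: cvg_entries_cst.
  apply: cvg_entries_mul; last exact: cvg_inv_pencil.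
  apply: cvg_entries_mul; first exact: cvg_inv_pencil.
  exact: cvg_entries_cst.
Qed.

End LogDet.

(** The first derivative of [tr S^-1] along [V] is [- tr (S^-1 V S^-1)], the
    second is [2 tr (S^-1 V S^-1 V S^-1)]. *)
Section TraceInverse.

Definition trinv_score p : R := \tr (invmx (pencil p)).

Definition trinv_grad p : 'rV[R]_m :=
  \row_j - \tr (invmx (pencil p) *m Ws j *m invmx (pencil p)).

Definition trinv_hess p : 'M[R]_m := \matrix_(i, j)
  (\tr (invmx (pencil p) *m Ws i *m invmx (pencil p) *m Ws j *m invmx (pencil p))
   + \tr (invmx (pencil p) *m Ws j *m invmx (pencil p) *m Ws i *m invmx (pencil p))).

Let hessE p v j (P := invmx (pencil p)) : (v *m trinv_hess p) 0 j
  = \tr (P *m pencil v *m P *m Ws j *m P) + \tr (P *m Ws j *m P *m pencil v *m P).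
Proof.
rewrite -(mulmxA (P *m pencil v)) -(mulmxA (P *m pencil v)) !trace_pencil.
rewrite -big_split mxE; apply: eq_bigr => i _.
by rewrite !mxE -/P !mulmxA mulrDr.
Qed.

Lemma trinv_smooth_convex :
  smooth_convex pencil_domain trinv_score trinv_grad trinv_hess.
Proof.
split.
- exact: pencil_domain_open.
- exact: pencil_domain_segment.
- move=> p v Up.
  have -> : dotp (trinv_grad p) v
      = \tr (- (invmx (pencil p) *m pencil v *m invmx (pencil p))).
    rewrite linearN /= trace_pencil -sumrN; apply: eq_bigr => i _.
    by rewrite mxE mulrC mulrN.
  by apply: is_derive_trace; apply: mx_derive_inv_pencil; exact: posdef_unit.
- move=> p v j Up; rewrite hessE.
  have -> : (fun q => trinv_grad q 0 j)
      = - (fun q => \tr (invmx (pencil q) *m Ws j *m invmx (pencil q))).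
    by apply/funext => q; rewrite mxE.
  have dinv := mx_derive_inv_pencil v (posdef_unit Up).
  have := is_derive_trace
    (mx_derive_mul (mx_derive_mul dinv (mx_derive_cst p v (Ws j))) dinv).
  rewrite mulmx0 addr0 mulmxN !mulNmx -opprD linearN linearD /= !mulmxA => dtr.
  by apply: is_derive_eq; rewrite opprK.
- move=> p v Up.
  have -> : dotp (v *m trinv_hess p) v
      = 2 * \tr (invmx (pencil p) *m pencil v *m invmx (pencil p) *m pencil v
              *m invmx (pencil p)).
    rewrite mulr_natl mulr2n {1}trace_pencil.
    rewrite -[in X in _ = _ + X]mulmxA -[in X in _ = _ + X]mulmxA trace_pencil.
    rewrite -big_split; apply: eq_bigr => j _ /=.
    by rewrite hessE !mulmxA mulrDl !(mulrC (v 0 j)).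
  by rewrite mulr_ge0// (trace_invmx_cube_ge0 Up (pencil_sym v)).
- exact: cvg_trace_inv_pencil.
- move=> p j Up.
  have -> : (fun q => trinv_grad q 0 j)
      = (fun q => - \tr (invmx (pencil q) *m Ws j *m invmx (pencil q))).
    by apply/funext => q; rewrite mxE.
  apply: continuousN; apply: (cvg_trace (F := nbhs p)).
  apply: cvg_entries_mul; last exact: cvg_inv_pencil.
  apply: cvg_entries_mul; first exact: cvg_inv_pencil.
  exact: cvg_entries_cst.
- have cvg5 p i j : pencil_domain p -> \tr (invmx (pencil q) *m Ws i *m
        invmx (pencil q) *m Ws j *m invmx (pencil q)) @[q --> p]
      --> \tr (invmx (pencil p) *m Ws i *m
        invmx (pencil p) *m Ws j *m invmx (pencil p)).
    move=> Up; have inv := cvg_inv_pencil Up.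
    have cst k : cvg_entries (nbhs p) (fun=> Ws k) (Ws k) by exact: cvg_entries_cst.
    apply: (cvg_trace (F := nbhs p)).
    by do ![exact: inv | exact: cst | apply: cvg_entries_mul].
  move=> p i j Up.
  have -> : (fun q => trinv_hess q i j) = (fun q =>
      \tr (invmx (pencil q) *m Ws i *m invmx (pencil q) *m Ws j *m invmx (pencil q))
      + \tr (invmx (pencil q) *m Ws j *m invmx (pencil q) *m Ws i *m invmx (pencil q))).
    by apply/funext => q; rewrite mxE.
  by apply: continuousD; exact: cvg5.
Qed.

End TraceInverse.

Section SublevelSets.
Variable C : set 'rV[R]_m.
Hypothesis Cc : compact C.

Let closed_le_cont (k l : 'rV[R]_m -> R) : continuous k -> continuous l ->
  closed [set p | k p <= l p].
Proof.
move=> kc lc; have -> : [set p | k p <= l p] = (fun p => l p - k p) @^-1` [set x | 0 <= x].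
  by apply/seteqP; split=> p /=; rewrite subr_ge0.
apply: closed_comp; last exact: closed_ge.
by move=> p _; apply: continuousB; [exact: lc|exact: kc].
Qed.

Let closed_forall (k l : 'cV[R]_n -> 'rV[R]_m -> R) :
  (forall x, continuous (k x)) -> (forall x, continuous (l x)) ->
  closed [set p | forall x, k x p <= l x p].
Proof.
move=> kc lc.
have -> : [set p | forall x, k x p <= l x p] = \bigcap_(x in setT) [set p | k x p <= l x p].
  by apply/seteqP; split=> p /= h x; [move=> _|]; exact: h.
by apply: closed_bigI => x _; exact: closed_le_cont.
Qed.

Let det_cont : continuous (fun p => \det (pencil p)).
Proof. by move=> p; apply: (cvg_det (F := nbhs p)); exact: cvg_pencil. Qed.

Let tr_adj_cont : continuous (fun p => \tr (\adj (pencil p))).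
Proof.
by move=> p; apply: (cvg_trace (F := nbhs p)); apply: cvg_entries_adj; exact: cvg_pencil.
Qed.

Let qform_cont x : continuous (fun p => qform (pencil p) x).
Proof.
move=> p.
have cst k l (A : 'M[R]_(k, l)) : cvg_entries (nbhs p) (fun=> A) A by exact: cvg_entries_cst.
have pc : cvg_entries (nbhs p) pencil (pencil p) by exact: cvg_pencil.
have : cvg_entries (nbhs p) (fun q => x^T *m pencil q *m x) (x^T *m pencil p *m x).
  by do ![exact: cst | exact: pc | apply: cvg_entries_mul].
exact.
Qed.

Let cst_cont (c : R) : continuous (fun _ : 'rV[R]_m => c).
Proof. by move=> p; exact: cst_continuous. Qed.

Let mul_cont (k l : 'rV[R]_m -> R) : continuous k -> continuous l ->
  continuous (fun p => k p * l p).
Proof. by move=> kc lc p; apply: continuousM; [exact: kc|exact: lc]. Qed.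

Let sumsq (x : 'cV[R]_n) : R := \sum_i x i 0 ^+ 2.

Let trace_inv p : pencil_domain p ->
  \tr (\adj (pencil p)) = \det (pencil p) * \tr (invmx (pencil p)).
Proof.
move=> Up; rewrite /invmx (posdef_unit Up) linearZ /= mulrA divff ?mul1r//.
by rewrite gt_eqF// posdef_det.
Qed.

(** A lower bound on the determinant keeps the limits away from the boundary:
    multiplying the coercivity estimate by [det W] gives
    [det W |x|^2 <= tr (adj W) x^T W x], a closed condition. *)
Lemma logdet_sublevel_compact p0 : pencil_domain p0 ->
  compact (sublevel C pencil_domain logdet_score p0).
Proof.
move=> U0; have d0 : 0 < \det (pencil p0) by exact: posdef_det.
pose Z := [set p | \det (pencil p0) <= \det (pencil p)]
  `&` [set p | forall x, 0 <= qform (pencil p) x]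
  `&` [set p | forall x, \det (pencil p) * sumsq x
                 <= \tr (\adj (pencil p)) * qform (pencil p) x].
have -> : sublevel C pencil_domain logdet_score p0 = C `&` Z.
  apply/seteqP; split=> p.
    move=> [[Cp Up] fp]; have dp := posdef_det Up.
    have q0 x := posdef_qform_ge0 x Up.
    split=> //; split; first split=> //.
      by move: fp; rewrite /logdet_score lerN2 ler_ln.
    move=> x; rewrite trace_inv// -mulrA ler_pM2l//; exact: posdef_coercive.
  move=> [Cp [[/= dp q0] coer]]; have dp0 := lt_le_trans d0 dp.
  have Up : pencil_domain p.
    split=> [|x x0]; first exact: pencil_sym.
    rewrite lt_neqAle q0 andbT; apply/eqP => qx.
    have := coer x; rewrite /qform -qx mulr0 leNgt mulr_gt0//.
    exact: sum_sqr_gt0.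
  by split=> //; rewrite /logdet_score lerN2 ler_ln.
apply: compact_closedI => //; apply: closedI; first apply: closedI.
- exact: closed_le_cont.
- by apply: closed_forall => x; [exact: cst_cont|exact: qform_cont].
- apply: closed_forall => x; first by apply: mul_cont => //; exact: cst_cont.
  by apply: mul_cont => //; exact: qform_cont.
Qed.

(** The coercivity estimate with [tr (W^-1) <= c] reads [|x|^2 <= c x^T W x],
    which passes to limits and forces positive definiteness. *)
Lemma trinv_sublevel_compact p0 : pencil_domain p0 ->
  compact (sublevel C pencil_domain trinv_score p0).
Proof.
move=> U0; set c := trinv_score p0.
have c0 : 0 <= c by exact: posdef_trace_inv_ge0.
pose Z := [set p | forall x, sumsq x <= c * qform (pencil p) x]
  `&` [set p | \tr (\adj (pencil p)) <= c * \det (pencil p)].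
have -> : sublevel C pencil_domain trinv_score p0 = C `&` Z.
  apply/seteqP; split=> p.
    move=> [[Cp Up] fp]; have dp := posdef_det Up.
    have q0 x := posdef_qform_ge0 x Up.
    split=> //; split=> /= [x|].
      by apply: le_trans (posdef_coercive x Up) _; rewrite ler_wpM2r.
    by rewrite trace_inv// mulrC ler_pM2r.
  move=> [Cp [/= coer adj_le]].
  have Up : pencil_domain p.
    split=> [|x x0]; first exact: pencil_sym.
    have := lt_le_trans (sum_sqr_gt0 x0) (coer x).
    rewrite -/(qform _ _) => cq; rewrite ltNge; apply/negP => q0.
    by have := mulr_ge0_le0 c0 q0; rewrite leNgt cq.
  split=> //; have dp := posdef_det Up.
  by move: adj_le; rewrite trace_inv// mulrC ler_pM2r.
apply: compact_closedI => //; apply: closedI.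
- apply: closed_forall => x; first exact: cst_cont.
  by apply: mul_cont; [exact: cst_cont|exact: qform_cont].
- by apply: closed_le_cont => //; apply: mul_cont => //; exact: cst_cont.
Qed.

End SublevelSets.

End Pencil.

(** * Gramians *)

Section GramianSymmetry.
Context {R : realType} {n : nat}.

Lemma trmx_continuous : continuous (@trmx R n n).
Proof.
move=> M; apply: (cvg_mx (F := nbhs M)) => i j; rewrite mxE.
under eq_fun do rewrite mxE.
exact: coord_continuous.
Qed.

(** Transposition is a homeomorphism, so the two sequences converge or diverge
    together; when they diverge both limits are the default matrix, which is
    symmetric. *)
Lemma trmx_lim (u : nat -> 'M[R]_n) : limn (fun k => (u k)^T) = (limn u)^T.
Proof.
have cvg_tr (w : nat -> 'M[R]_n) : cvgn w -> (fun k => (w k)^T) @ \oo --> (limn w)^T.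
  by move=> wc; apply: (continuous_cvg _ (trmx_continuous (x := _))).
have [uc|udv] := pselect (cvgn u).
  by apply: cvg_lim => //; exact: cvg_tr.
rewrite (dvgP udv) dvgP.
  by apply/matrixP => i j; rewrite !mxE.
move=> /cvg_tr h; apply: udv; apply/cvg_ex.
exists (limn (fun k => (u k)^T))^T.
by move: h; under eq_fun do rewrite trmxK.
Qed.

Lemma trmx_mxexp (M : 'M[R]_n) : mxexp M^T = (mxexp M)^T.
Proof.
rewrite /mxexp -trmx_lim; congr (limn _); apply/funext => k.
rewrite /series /= linear_sum; apply: eq_bigr => i _.
rewrite linearZ /=; congr (_ *: _).
elim: i => [|i IH]; first by rewrite !expr0 [RHS]trmx1.
by rewrite exprS exprSr IH [RHS]trmx_mul.
Qed.

Lemma gramian1_sym (A : 'M[R]_n) (b : 'cV[R]_n) (T : R) :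
  (gramian1 A b T)^T = gramian1 A b T.
Proof.
apply/matrixP => k l; rewrite !mxE; apply: eq_Rintegral => t _.
set M := _ *m _.
suff MT : M^T = M by rewrite -[in LHS]MT mxE.
rewrite /M !trmx_mul trmxK -[t *: A^T]linearZ /= trmx_mxexp trmxK !mulmxA.
by [].
Qed.

End GramianSymmetry.

Section GramianScores.
Context {R : realType} {n m : nat}.
Variables (A : 'M[R]_n) (b : 'I_m -> 'cV[R]_n) (T : R).
Let U := gramian_domain A b T.

Lemma gramian_score_smooth_convex (C : set 'rV[R]_m) (f : 'rV[R]_m -> R) :
  compact C -> f = fV A b T \/ f = fA A b T ->
  exists g H, smooth_convex U f g H /\
    forall p0, U p0 -> compact (sublevel C U f p0).
Proof.
move=> Cc; have Wsym i : (gramian1 A (b i) T)^T = gramian1 A (b i) T.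
  exact: gramian1_sym.
case=> ->; do 2 eexists; split.
- exact: logdet_smooth_convex Wsym.
- by move=> p0; exact: logdet_sublevel_compact.
- exact: trinv_smooth_convex Wsym.
- by move=> p0; exact: trinv_sublevel_compact.
Qed.

End GramianScores.

Theorem theorem4 (R : realType) (n m : nat) (A : 'M[R]_n)
    (b : 'I_m -> 'cV[R]_n) (T : R) (C : set 'rV[R]_m) (f : 'rV[R]_m -> R)
    (hm : (1 <= m)%N) (hT : 0 < T)
    (hCsub : C `<=` @simplex R m) (hC0 : C !=set0) (hCcpt : compact C)
    (hCcvx : @convex_set R 'rV[R]_m C)
    (hfeas : C `&` gramian_domain A b T !=set0)
    (hf : f = fV A b T \/ f = fA A b T) :
  let U := gramian_domain A b T in
  (exists p, optimal C U f p) /\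
  forall (p0 : 'rV[R]_m) (abar sigma rho : R),
    (C `&` U) p0 -> 0 < abar -> 0 < sigma < 1 -> 0 < rho < 1 ->
    compact (sublevel C U f p0) /\
    (forall (eps : R), 0 <= eps ->
       forall (k : nat) (p : 'rV[R]_m),
         iterate C U f abar sigma rho eps p0 k p ->
         [/\ exists (a : R) (q : 'rV[R]_m),
               backtrack C U f sigma rho p abar a q,
             sublevel C U f p0 p &
             forall (a : R) (q : 'rV[R]_m),
               backtrack C U f sigma rho p abar a q ->
               sublevel C U f p0 q]) /\
    (forall p : 'rV[R]_m,
       returns C U f abar sigma rho 0 p0 p -> optimal C U f p) /\
    ((exists p : 'rV[R]_m, returns C U f abar sigma rho 0 p0 p) \/
     (exists (p : nat -> 'rV[R]_m) (a : nat -> R),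
        infinite_run C U f abar sigma rho 0 p0 p a)) /\
    (forall (p : nat -> 'rV[R]_m) (a : nat -> R),
       infinite_run C U f abar sigma rho 0 p0 p a ->
       let G := fun k : nat => norm2 (gradient_mapping C f (a k) (p k)) in
       let alow := step_lower C U f abar sigma rho p0 in
       [/\ exists q : 'rV[R]_m, optimal C U f q /\ p @ \oo --> q,
           forall pstar : 'rV[R]_m, optimal C U f pstar ->
             forall K : nat,
               \big[Num.min/G 0%N]_(k < K.+1) G k
                 <= Num.sqrt ((f p0 - f pstar) / (sigma * alow * K.+1%:R))
               /\
               f (p K) - f pstar
                 <= (norm2 (p0 - pstar) ^+ 2
                      + 2 * abar * (f p0 - f pstar) / sigma)
                    / (2 * alow * K.+1%:R) &
           G @ \oo --> (0 : R)]).
Proof.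
move=> U; have [g [H [sc sublevel_compact]]] := gramian_score_smooth_convex hCcpt hf.
have fcont p : U p -> {for p, continuous f} by exact: (sc_cont sc).
have fconv p q : U p -> U q -> f p + dotp (grad f p) (q - p) <= f q.
  by move=> Up Uq; rewrite (gradE sc Up); exact: (sc_gradient_inequality sc).
have opt : exists p, optimal C U f p.
  case: hfeas => p0 CUp0; apply: (optimal_exists fcont CUp0).
  exact: sublevel_compact (proj2 CUp0).
split=> // p0 abar sigma rho CUp0 abar0 /andP[sigma0 sigma1] rho01.
have Kc := sublevel_compact _ (proj2 CUp0).
have astar0 := step_star_gt0 sc Kc sigma1.
have small p a : sublevel C U f p0 p -> 0 < a ->
    a <= step_star C U f sigma p0 -> accepted C U f sigma p a.
  exact: (small_step_accepted sc Kc hC0 hCcpt hCcvx sigma1).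
split=> //; split; [|split; [|split]].
- move=> eps _ k p it.
  have Kp : sublevel C U f p0 p.
    exact: (iterate_sublevel hC0 hCcpt hCcvx CUp0 abar0 sigma0 rho01 astar0 small it).
  split=> //; first exact: (backtrack_exists rho01 astar0 small Kp abar0).
  move=> a q.
  exact: (backtrack_sublevel hC0 hCcpt hCcvx abar0 sigma0 rho01 astar0 small Kp).
- move=> p.
  exact: (returns_optimal hC0 hCcpt hCcvx fconv CUp0 abar0 sigma0 rho01 astar0 small).
- exact: (returns_or_infinite hC0 hCcpt hCcvx CUp0 abar0 sigma0 rho01 astar0 small).
move=> p a run; split.
- exact: (iterates_converge hC0 hCcpt hCcvx fconv fcont CUp0 Kc abar0 sigma0 rho01
    astar0 small run opt).
- move=> x xopt K; split.
    exact: (min_gradient_mapping_rate hC0 hCcpt hCcvx CUp0 abar0 sigma0 rho01 astar0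
      small run xopt).
  exact: (value_rate hC0 hCcpt hCcvx fconv CUp0 abar0 sigma0 rho01 astar0 small run
    xopt).
- exact: (gradient_mapping_cvg0 hC0 hCcpt hCcvx CUp0 abar0 sigma0 rho01 astar0 small
    run opt).
Qed.
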